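(* Let $\chi$ be a quadratic primitive Dirichlet character modulo $q$. Suppose that either $\chi$ is even and $q\ge 2\cdot 10^{49}$, or $\chi$ is odd and $q\ge 5\cdot 10^{50}$. Then $L(1,\chi)\le \frac{9}{20}\log q$.
   Context: $L(s,\chi)=\sum_{n\ge1}\chi(n)n^{-s}$ is the Dirichlet $L$-function of $\chi$. A character is even if $\chi(-1)=1$, odd if $\chi(-1)=-1$, and quadratic if it takes only real values (and is non-principal). *)

(* Defs.v *)
From HB Require Import structures.
From mathcomp Require Export all_boot all_order all_algebra.
From mathcomp Require Export all_classical all_reals all_analysis.
From mathcomp Require Export complex.

Set Implicit Arguments.
Unset Strict Implicit.
Unset Printing Implicit Defensive.

Export Order.TTheory GRing.Theory Num.Theory.
Export numFieldNormedType.Exports.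
#[global] Open Scope classical_set_scope.
#[global] Open Scope ring_scope.
#[global] Open Scope complex_scope.

Definition dirichlet_character (R : realType) (q : nat) (chi : int -> R[i]) : Prop :=
  [/\ (0 < q)%N,
      forall a b : int, chi (a * b) = chi a * chi b,
      forall a : int, chi (a + q%:Z) = chi a
    & forall a : int, (chi a != 0) = coprimez a q%:Z].

Definition principal_character (R : realType) (q : nat) (chi : int -> R[i]) : Prop :=
  forall a : int, coprimez a q%:Z -> chi a = 1.

Definition induced_modulus (R : realType) (q : nat) (chi : int -> R[i]) (d : nat) : Prop :=
  (d %| q)%N /\
  (forall a : int, coprimez a q%:Z -> (a = 1 %[mod d%:Z])%Z -> chi a = 1).

(* Conductor equal to q: no proper divisor of q is an induced modulus. *)
Definition primitive_character (R : realType) (q : nat) (chi : int -> R[i]) : Prop :=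
  forall d : nat, induced_modulus q chi d -> d = q.

Definition quadratic_character (R : realType) (q : nat) (chi : int -> R[i]) : Prop :=
  (forall a : int, chi a \is Num.real) /\ ~ principal_character q chi.

Definition even_character (R : realType) (chi : int -> R[i]) : Prop := chi (-1) = 1.

Definition odd_character (R : realType) (chi : int -> R[i]) : Prop := chi (-1) = -1.

(* x ^ (-s) = x ^ (-Re s) * exp (- i * Im s * log x) for real x > 0. *)
Definition cpowN (R : realType) (x : R) (s : R[i]) : R[i] :=
  (x `^ (- complex.Re s))%:C * (cos (complex.Im s * ln x) -i* sin (complex.Im s * ln x)).

(* The sum of the series, so meaningful only where it converges: for 0 < Re s
   when chi is a non-principal Dirichlet character. *)
Definition dirichletL (R : realType) (chi : int -> R[i]) (s : R[i]) : R[i] :=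
  limn (series (fun n : nat => chi n.+1%:Z * cpowN n.+1%:R s) : R[i]^o ^nat).

(* Main.v *)
Require Import Defs.
From mathcomp Require Import ring lra zify.
From mathcomp Require cyclic separable cyclotomic.

Set Implicit Arguments.
Unset Strict Implicit.
Unset Printing Implicit Defensive.

(** Put r = 1 - chi, so that 0 <= r <= 2. Pairing chi with the triangular weight
    [tent N] and expanding through the Gauss sum gives
    |sum_n chi(n) tent_N(n)| <= sqrt(q) N / 2. Hence chi averages to almost 0 at
    the scale 60 sqrt(q), and L(1, chi) is within 2 sqrt(q) / N of a sum whose
    weights are 1/n smoothly cut off at N. If L(1, chi) were larger than
    (9/20) log q, then sum r(n)/n would be small. Writing log = 1 * Lambda and
    using r(d) - r(m) <= r(d m) <= r(d) + r(m) at the scales 60 sqrt(q) and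
    5 sqrt(q), where sums of Lambda against [tent N] are controlled by a
    Chebyshev-type bound, this forces r to be small on average at the scale
    60 sqrt(q), which contradicts the vanishing of the average of chi there. *)

(** Tents are used throughout because a tent is a convolution of two intervals: its Fourier
    transform is a product of two Dirichlet kernels, which Parseval bounds without the logarithm
    that a sharp cutoff costs, and the smooth cutoff of 1/n is a positive mixture of tents.

    The obstacle is that two scales are needed. The mean of r is near 1 only well beyond sqrt(q),
    whereas the mass of r that a large L(1, chi) leaves, about ln M - L(1, chi) at scale M, grows
    with M. So sums of Lambda(d) r(d) must be moved from scale M (about 5 sqrt(q)) to 12 M; where
    the comparison is lossy, only r <= 2 is available. With l = ln M, with D the sum of r against
    the cutoff at M, and with Om about ln(M / Y) the mass of the tents of width between Y and M,
    this move bounds the normalised prime sum by about (l / Om) D + Om. The contradiction needs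
    this, plus 11/10 of the similar D at 8 M, to stay below l. Since D is about l / 10, the leading
    terms leave room; the lower order terms decide how large q must be. *)

(** * Tents and their sums over multiples *)

Definition tent (N n : nat) : nat := minn n (N - n).

Definition tent_sum (K N d : nat) : nat := (\sum_(m < K) tent N (d * m))%N.

Lemma tent_eq0 N n : (N <= n)%N -> tent N n = 0%N.
Proof. by rewrite /tent => ?; lia. Qed.

Lemma tent0 N : tent N 0 = 0%N.
Proof. by rewrite /tent min0n. Qed.

Lemma tent_le N n : (tent N n <= n)%N.
Proof. by rewrite /tent geq_minl. Qed.

(** The increment is written as a difference of truncated subtractions so that it telescopes when x
    runs over the multiples of d, including at the edge of the tent. *)
Lemma tent_shift N d x :
  (tent (N + 2 * d) (x + d) = tent N x + ((N + d - x) - (N + d - (x + d))))%N.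
Proof. by rewrite /tent; lia. Qed.

(** For fixed d, the tent is piecewise linear in its width, with breaks only at the integers d and 2
    d, hence linear between N and N + 1. This is its value at the width N + rho / m, scaled by m; it
    reduces sums over multiples of m to tents of the two neighbouring integer widths. *)
Lemma tent_interpolate N m rho d : (rho <= m)%N ->
  (tent (N * m + rho) (d * m) = (m - rho) * tent N d + rho * tent N.+1 d)%N.
Proof.
move=> le_rho; rewrite /tent.
have [le_dN|lt_Nd] := leqP (2 * d) N.
  have -> : minn d (N - d) = d by lia.
  have -> : minn d (N.+1 - d) = d by lia.
  have -> : minn (d * m) (N * m + rho - d * m) = (d * m)%N by nia.
  nia.
have [le_dN|lt_N_d] := leqP d N.
  have -> : minn d (N - d) = (N - d)%N by lia.
  have -> : minn d (N.+1 - d) = (N.+1 - d)%N by lia.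
  have -> : minn (d * m) (N * m + rho - d * m) = (N * m + rho - d * m)%N by nia.
  nia.
have -> : minn d (N - d) = 0%N by lia.
have -> : minn d (N.+1 - d) = 0%N by lia.
nia.
Qed.

Lemma telescope_subn (a : nat -> nat) K :
  (forall i, a i.+1 <= a i)%N -> (\sum_(i < K) (a i - a i.+1) = a 0 - a K)%N.
Proof.
move=> a_dec; elim: K => [|K IHK]; first by rewrite big_ord0 subnn.
rewrite big_ord_recr /= IHK.
have le_K : (a K <= a 0)%N by elim: {IHK} K => // k; exact: leq_trans.
by have := a_dec K; lia.
Qed.

Lemma tent_sum_widen K N d : (N <= K)%N -> (0 < d)%N ->
  tent_sum K N d = tent_sum N N d.
Proof.
move=> leNK d_gt0; rewrite /tent_sum -!(big_mkord xpredT (fun m => tent N (d * m))).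
rewrite (big_cat_nat (leq0n N) leNK) /= -[RHS]addn0; congr addn.
rewrite big_nat_cond big1 // => i.
by rewrite andbT => /andP[leNi _]; apply: tent_eq0; nia.
Qed.

Lemma tent_sum_step K N d : (0 < d)%N -> (N < K)%N ->
  (tent_sum K.+1 (N + 2 * d) d = tent_sum K N d + (N + d))%N.
Proof.
move=> d_gt0 ltNK; rewrite /tent_sum big_ord_recl muln0 tent0 add0n.
under eq_bigr => i _ do rewrite lift0 mulnS [(d + d * i)%N]addnC tent_shift.
rewrite big_split /=; congr addn.
under eq_bigr => i _ do rewrite [(d * i + d)%N]addnC -mulnS.
rewrite (@telescope_subn (fun i => N + d - d * i)%N); last by move=> i; nia.
by rewrite muln0 subn0; nia.
Qed.

Lemma tent_sum_base K N d : (0 < d)%N -> (N <= 2 * d)%N -> (N <= K)%N ->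
  tent_sum K N d = (N - d)%N.
Proof.
move=> d_gt0 leN2d leNK; rewrite (@tent_sum_widen K) //.
rewrite -(@tent_sum_widen N.+2 N) //; last by lia.
rewrite /tent_sum !big_ord_recl /= big1 => [|i _]; last first.
  by rewrite /bump /= tent_eq0 //; nia.
by rewrite /bump /tent /=; lia.
Qed.

(** Here k is the integer nearest to N / (2 d); at a tie both candidates give the same value.
    Narrowing the tent by 2 d lowers k by one. *)
Lemma tent_sumE k K N d : (0 < d)%N -> (N <= K)%N ->
  (2 * k * d <= N + d)%N -> (N <= 2 * k * d + d)%N ->
  (tent_sum K N d + k * k * d = k * N)%N.
Proof.
move=> d_gt0; elim: k K N => [|k IHk] K N leNK le1 le2.
  by rewrite tent_sum_base //; lia.
have [leN2d|lt2dN] := leqP N (2 * d).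
  by rewrite tent_sum_base //; have -> : k = 0%N by [nia]; lia.
case: K leNK => [|K] leNK; first by lia.
have eN : N = (N - 2 * d + 2 * d)%N by lia.
rewrite eN tent_sum_step //; last by lia.
have := IHk K (N - 2 * d)%N; set T := tent_sum _ _ _ => IH.
have {IH} : (T + k * k * d = k * (N - 2 * d))%N by apply: IH; nia.
move: le1 le2; nia.
Qed.

(** With k as in [tent_sumE], N^2 - 4 d T = (N - 2 k d)^2. It is nonnegative, which is the bound
    here, and at most d^2, which is the companion lower bound. *)
Lemma tent_sum_ub K N d : (0 < d)%N -> (N <= K)%N -> (4 * d * tent_sum K N d <= N * N)%N.
Proof.
move=> d_gt0 leNK; pose k := ((N + d) %/ (2 * d))%N.
have d2_gt0 : (0 < 2 * d)%N by lia.
have le1 : (k * (2 * d) <= N + d)%N by rewrite leq_trunc_div.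
have lt2 : (N + d < k.+1 * (2 * d))%N by rewrite ltn_ceil.
have := @tent_sumE k K N d d_gt0 leNK; set T := tent_sum _ _ _ => eT.
have {eT} : (T + k * k * d = k * N)%N by apply: eT; nia.
move: k T {le1 lt2} => k T eT.
have eZ : T%:Z = k%:Z * N%:Z - k%:Z * k%:Z * d%:Z by lia.
suff : 4 * d%:Z * T%:Z <= N%:Z * N%:Z by lia.
rewrite eZ -subr_ge0; have := sqr_ge0 (N%:Z - 2 * k%:Z * d%:Z).
by congr (_ <= _); ring.
Qed.

Lemma tent_sum_lb K N d : (0 < d)%N -> (N <= K)%N ->
  (N * N <= 4 * d * tent_sum K N d + d * d)%N.
Proof.
move=> d_gt0 leNK; pose k := ((N + d) %/ (2 * d))%N.
have d2_gt0 : (0 < 2 * d)%N by lia.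
have le1 : (k * (2 * d) <= N + d)%N by rewrite leq_trunc_div.
have lt2 : (N + d < k.+1 * (2 * d))%N by rewrite ltn_ceil.
have := @tent_sumE k K N d d_gt0 leNK; set T := tent_sum _ _ _ => eT.
have {eT} : (T + k * k * d = k * N)%N by apply: eT; nia.
move: k T le1 lt2 => k T le1 lt2 eT.
have eZ : T%:Z = k%:Z * N%:Z - k%:Z * k%:Z * d%:Z by lia.
suff : N%:Z * N%:Z <= 4 * d%:Z * T%:Z + d%:Z * d%:Z by lia.
rewrite eZ.
have h1 : 0 <= N%:Z + d%:Z - 2 * k%:Z * d%:Z by nia.
have h2 : 0 <= d%:Z + 2 * k%:Z * d%:Z - N%:Z by nia.
by rewrite -subr_ge0; have := mulr_ge0 h1 h2; congr (_ <= _); ring.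
Qed.

(** Because 1 - 1/2 - 1/3 - 1/6 = 0, everything that involves k cancels: the combination depends on
    N only modulo 12 D. The u_j are the integers nearest to N0 / (2 j D). *)
Lemma tent_kernel_residue K k D N0 u1 u2 u3 u6 (N := (12 * D * k + N0)%N) :
  (0 < D)%N -> (N <= K)%N ->
  (2 * u1 * D <= N0 + D)%N -> (N0 <= 2 * u1 * D + D)%N ->
  (4 * u2 * D <= N0 + 2 * D)%N -> (N0 <= 4 * u2 * D + 2 * D)%N ->
  (6 * u3 * D <= N0 + 3 * D)%N -> (N0 <= 6 * u3 * D + 3 * D)%N ->
  (12 * u6 * D <= N0 + 6 * D)%N -> (N0 <= 12 * u6 * D + 6 * D)%N ->
  (tent_sum K N D)%:Z - (tent_sum K N (2 * D))%:Z - (tent_sum K N (3 * D))%:Z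
    - (tent_sum K N (6 * D))%:Z =
  (u1%:Z - u2%:Z - u3%:Z - u6%:Z) * N0%:Z
    + (2 * u2%:Z ^+ 2 + 3 * u3%:Z ^+ 2 + 6 * u6%:Z ^+ 2 - u1%:Z ^+ 2) * D%:Z.
Proof.
move=> D_gt0 leNK h1 h1' h2 h2' h3 h3' h6 h6'.
have e1 := @tent_sumE (6 * k + u1) K N D D_gt0 leNK.
have e2 := @tent_sumE (3 * k + u2) K N (2 * D) ltac:(lia) leNK.
have e3 := @tent_sumE (2 * k + u3) K N (3 * D) ltac:(lia) leNK.
have e6 := @tent_sumE (k + u6) K N (6 * D) ltac:(lia) leNK.
move: (tent_sum K N D) (tent_sum K N (2 * D)) (tent_sum K N (3 * D))
  (tent_sum K N (6 * D)) e1 e2 e3 e6 => T1 T2 T3 T6.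
rewrite /N => e1 e2 e3 e6.
have {}e1 := e1 ltac:(lia) ltac:(lia).
have {}e2 := e2 ltac:(lia) ltac:(lia).
have {}e3 := e3 ltac:(lia) ltac:(lia).
have {}e6 := e6 ltac:(lia) ltac:(lia).
have -> : T1%:Z = (6 * k%:Z + u1%:Z) * (12 * D%:Z * k%:Z + N0%:Z)
    - (6 * k%:Z + u1%:Z) ^+ 2 * D%:Z by lia.
have -> : T2%:Z = (3 * k%:Z + u2%:Z) * (12 * D%:Z * k%:Z + N0%:Z)
    - (3 * k%:Z + u2%:Z) ^+ 2 * (2 * D%:Z) by lia.
have -> : T3%:Z = (2 * k%:Z + u3%:Z) * (12 * D%:Z * k%:Z + N0%:Z)
    - (2 * k%:Z + u3%:Z) ^+ 2 * (3 * D%:Z) by lia.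
have -> : T6%:Z = (k%:Z + u6%:Z) * (12 * D%:Z * k%:Z + N0%:Z)
    - (k%:Z + u6%:Z) ^+ 2 * (6 * D%:Z) by lia.
ring.
Qed.

(** A Chebyshev kernel for tents. The periodic combination is nonnegative and reaches D except when
    N is within 2 D of a multiple of 12 D; there the tent at 6 D makes up for it. The factor 1/5 is
    sharp at N = 11 D, where the combination vanishes and [tent N (6 * D)] is 5 D. *)
Lemma tent_kernel K N D : (0 < D)%N -> (N <= K)%N ->
  (5 * tent N D + 5 * tent_sum K N (2 * D) + 5 * tent_sum K N (3 * D)
     + 5 * tent_sum K N (6 * D) <= 5 * tent_sum K N D + tent N (6 * D))%N.
Proof.
move=> D_gt0 leNK; have D12 : (0 < 12 * D)%N by lia.
have eN := divn_eq N (12 * D); have ltN0 := ltn_pmod N D12.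
move: (N %/ _)%N (N %% _)%N eN ltN0 leNK => k N0 -> ltN0.
rewrite (mulnC k) => leNK.
pose t := (N0 %/ D)%N.
have le1 : (t * D <= N0)%N by rewrite leq_trunc_div.
have lt2 : (N0 < t.+1 * D)%N by rewrite ltn_ceil.
have t12 : (t < 12)%N by nia.
have aux u1 u2 u3 u6 := @tent_kernel_residue K k D N0 u1 u2 u3 u6 D_gt0 leNK.
move: (tent_sum _ _ _) (tent_sum _ _ _) (tent_sum _ _ _) (tent_sum _ _ _) aux
  => T1 T2 T3 T6 aux.
move: t le1 lt2 t12 => t le1 lt2 t12.
(* Below 12 D the tents at D and 6 D still vary with N; from 12 D on they are D and 6 D. In both
   tables the quadruples are the nearest integers u_j for t D <= N0 < (t + 1) D. *)
have [k0|k_gt0] := posnP k.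
  rewrite k0 muln0 add0n /tent.
  case: t le1 lt2 t12 => [|t] le1 lt2 t12; first by have := aux 0%N 0%N 0%N 0%N; lia.
  case: t le1 lt2 t12 => [|t] le1 lt2 t12; first by have := aux 1%N 0%N 0%N 0%N; lia.
  case: t le1 lt2 t12 => [|t] le1 lt2 t12; first by have := aux 1%N 1%N 0%N 0%N; lia.
  case: t le1 lt2 t12 => [|t] le1 lt2 t12; first by have := aux 2%N 1%N 1%N 0%N; lia.
  case: t le1 lt2 t12 => [|t] le1 lt2 t12; first by have := aux 2%N 1%N 1%N 0%N; lia.
  case: t le1 lt2 t12 => [|t] le1 lt2 t12; first by have := aux 3%N 1%N 1%N 0%N; lia.
  case: t le1 lt2 t12 => [|t] le1 lt2 t12; first by have := aux 3%N 2%N 1%N 1%N; lia.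
  case: t le1 lt2 t12 => [|t] le1 lt2 t12; first by have := aux 4%N 2%N 1%N 1%N; lia.
  case: t le1 lt2 t12 => [|t] le1 lt2 t12; first by have := aux 4%N 2%N 1%N 1%N; lia.
  case: t le1 lt2 t12 => [|t] le1 lt2 t12; first by have := aux 5%N 2%N 2%N 1%N; lia.
  case: t le1 lt2 t12 => [|t] le1 lt2 t12; first by have := aux 5%N 3%N 2%N 1%N; lia.
  case: t le1 lt2 t12 => [|t] le1 lt2 t12; first by have := aux 6%N 3%N 2%N 1%N; lia.
  by [].
have -> : tent (12 * D * k + N0) D = D by rewrite /tent; nia.
have -> : tent (12 * D * k + N0) (6 * D) = (6 * D)%N by rewrite /tent; nia.
case: t le1 lt2 t12 => [|t] le1 lt2 t12; first by have := aux 0%N 0%N 0%N 0%N; lia.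
case: t le1 lt2 t12 => [|t] le1 lt2 t12; first by have := aux 1%N 0%N 0%N 0%N; lia.
case: t le1 lt2 t12 => [|t] le1 lt2 t12; first by have := aux 1%N 1%N 0%N 0%N; lia.
case: t le1 lt2 t12 => [|t] le1 lt2 t12; first by have := aux 2%N 1%N 1%N 0%N; lia.
case: t le1 lt2 t12 => [|t] le1 lt2 t12; first by have := aux 2%N 1%N 1%N 0%N; lia.
case: t le1 lt2 t12 => [|t] le1 lt2 t12; first by have := aux 3%N 1%N 1%N 0%N; lia.
case: t le1 lt2 t12 => [|t] le1 lt2 t12; first by have := aux 3%N 2%N 1%N 1%N; lia.
case: t le1 lt2 t12 => [|t] le1 lt2 t12; first by have := aux 4%N 2%N 1%N 1%N; lia.
case: t le1 lt2 t12 => [|t] le1 lt2 t12; first by have := aux 4%N 2%N 1%N 1%N; lia.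
case: t le1 lt2 t12 => [|t] le1 lt2 t12; first by have := aux 5%N 2%N 2%N 1%N; lia.
case: t le1 lt2 t12 => [|t] le1 lt2 t12; first by have := aux 5%N 3%N 2%N 1%N; lia.
case: t le1 lt2 t12 => [|t] le1 lt2 t12; first by have := aux 6%N 3%N 2%N 1%N; lia.
by [].
Qed.

(** * The von Mangoldt function and its convolution identity *)

(** The list of prime divisors is a singleton exactly for the positive powers of a prime; 0 and 1
    fall in the default branch. *)
Definition vonMangoldt (R : realType) (n : nat) : R :=
  if primes n is [:: p] then ln p%:R else 0.

Lemma vonMangoldt_ge0 (R : realType) n : 0 <= vonMangoldt R n.
Proof.
rewrite /vonMangoldt; case e: (primes n) => [|p [|p' s]] //.
have : p \in primes n by rewrite e inE.
by rewrite mem_primes => /andP[/prime_gt0 p_gt0 _]; rewrite ln_ge0 // ler1n.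
Qed.

Lemma vonMangoldt0 (R : realType) : vonMangoldt R 0 = 0.
Proof. by []. Qed.

Lemma vonMangoldtX (R : realType) p k : prime p -> vonMangoldt R (p ^ k.+1) = ln p%:R.
Proof. by move=> p_pr; rewrite /vonMangoldt primesX // primes_prime. Qed.

(** With prime powers expanded as indicators, a sum over the divisors of n becomes a count of the
    exponents k with p^(k+1) dividing n. *)
Lemma vonMangoldtE (R : realType) K d : (d < K)%N ->
  vonMangoldt R d =
  \sum_(p < K | prime p) \sum_(k < K) (d == p ^ k.+1)%N%:R * ln (p%:R : R).
Proof.
move=> ltdK.
have [[p p_pr [k ed]]|none] := pselect (exists2 p, prime p & exists k, d = (p ^ k.+1)%N).
  have p_gt1 := prime_gt1 p_pr.
  have ltpK : (p < K)%N.
    by apply: leq_ltn_trans ltdK; rewrite ed -{1}(expn1 p) leq_exp2l.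
  have ltkK : (k < K)%N.
    by apply: ltn_trans ltdK; rewrite ed (leq_trans (ltn_expl k p_gt1)) // leq_exp2l.
  rewrite {1}ed vonMangoldtX // (bigD1 (Ordinal ltpK)) //= (bigD1 (Ordinal ltkK)) //=.
  rewrite ed eqxx mul1r big1 ?addr0 => [|i ne_ik]; last first.
    rewrite (_ : (_ == _)%N = false) ?mul0r //; apply/negP => /eqP /(expnI p_gt1) [eki].
    by case/eqP: ne_ik; apply: val_inj.
  rewrite big1 ?addr0 // => p' /andP[p'_pr ne_p']; rewrite big1 // => i _.
  rewrite (_ : (_ == _)%N = false) ?mul0r //; apply/negP => /eqP e.
  have : primes (p ^ k.+1) = primes (p' ^ i.+1) by rewrite e.
  rewrite !primesX // !primes_prime // => -[ep].
  by case/eqP: ne_p'; apply: val_inj.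
rewrite big1 => [|p p_pr]; last first.
  rewrite big1 // => i _; rewrite (_ : (_ == _)%N = false) ?mul0r //.
  by apply/negP => /eqP ed; apply: none; exists (val p) => //; exists i.
rewrite /vonMangoldt; case e: (primes d) => [|p [|p' s]] //.
have : p \in primes d by rewrite e inE.
rewrite mem_primes => /and3P[p_pr d_gt0 p_d]; case: none; exists p => //.
exists (logn p d).-1; rewrite prednK; last by rewrite logn_gt0 e inE.
rewrite {1}(prod_prime_decomp d_gt0) prime_decompE e /= big_seq1 //.
Qed.

Lemma ln_logn (R : realType) K n : (0 < n < K)%N ->
  ln (n%:R : R) = \sum_(p < K | prime p) (logn p n)%:R * ln p%:R.
Proof.
case: K => [|K] // /andP[n_gt0 ltnK]; first by rewrite ltn0 in ltnK.
have {1}-> : n = (\prod_(p < K.+1 | prime p) p ^ logn p n)%N.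
  rewrite -{1}(partnT n_gt0) (@widen_partn K) // big_mkord big_mkcond [RHS]big_mkcond.
  by apply: eq_bigr => p _ /=; case: ifP => // /negbT p_npr; rewrite lognE (negbTE p_npr).
rewrite natr_prod; set P := \prod_(_ < _ | _) _; set S := \sum_(_ < _ | _) _.
suff [] : 0 < P /\ ln P = S by [].
rewrite {}/P {}/S; elim/big_rec2: _ => [|p y x p_pr [x_gt0 <-]].
  by rewrite ltr01 ln1.
have p_gt0 : 0 < (p%:R : R) by rewrite ltr0n prime_gt0.
rewrite natrX; split; first by rewrite mulr_gt0 // exprn_gt0.
by rewrite lnM ?posrE ?exprn_gt0 // lnXn // mulr_natl.
Qed.

Lemma sum_ltn_ord K e : (\sum_(k < K) (k < e) = minn K e)%N.
Proof.
elim: K => [|K IHK]; first by rewrite big_ord0 min0n.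
by rewrite big_ord_recr /= IHK; case: ltnP; lia.
Qed.

Lemma sum_vonMangoldt (R : realType) K n : (0 < n < K)%N ->
  \sum_(d < K | (d %| n)%N) vonMangoldt R d = ln n%:R.
Proof.
move=> n_bnd; have /andP[n_gt0 ltnK] := n_bnd.
under eq_bigr => d _ do rewrite (@vonMangoldtE R K) //.
rewrite exchange_big /= (@ln_logn R K n) //; apply: eq_bigr => p p_pr.
rewrite exchange_big /= -(minn_idPr (ltnW (ltn_trans (ltn_logl p n_gt0) ltnK))).
rewrite -sum_ltn_ord natr_sum mulr_suml; apply: eq_bigr => k _.
rewrite -mulr_suml -pfactor_dvdn //; congr (_ * _).
have [dvd_n|ndvd_n] := boolP (p ^ k.+1 %| n)%N; last first.
  rewrite big1 // => d dvd_d; case: eqP => // ed.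
  by rewrite -ed dvd_d in ndvd_n.
have ltK : (p ^ k.+1 < K)%N by rewrite (leq_ltn_trans _ ltnK) // dvdn_leq.
rewrite (bigD1 (Ordinal ltK)) //= eqxx big1 ?addr0 // => d /andP[_ /negP ne_d].
by case: eqP => // ed; case: ne_d; apply/eqP/val_inj.
Qed.

(** The pairs (d, m) fill a whole square: those with product at least K vanish by the support of G,
    those with product 0 because G 0 = 0. *)
Lemma sum_ln_vonMangoldt (R : realType) K (G : nat -> R) :
  G 0%N = 0 -> (forall n, (K <= n)%N -> G n = 0) ->
  \sum_(n < K) ln n%:R * G n = \sum_(d < K) vonMangoldt R d * \sum_(m < K) G (d * m)%N.
Proof.
move=> G0 GK.
have -> : \sum_(n < K) ln n%:R * G n =
    \sum_(n < K) \sum_(d < K | (d %| n)%N) vonMangoldt R d * G n.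
  apply: eq_bigr => n _; rewrite -mulr_suml.
  have [->|n_gt0] := posnP n; first by rewrite G0 !mulr0.
  by rewrite sum_vonMangoldt // n_gt0 ltn_ord.
rewrite (exchange_big_dep xpredT) //=; apply: eq_bigr => d _.
rewrite -mulr_sumr; have [d0|d_gt0] := posnP d.
  by rewrite {1 3}d0 vonMangoldt0 !mul0r.
congr (_ * _).
transitivity (\sum_(n < K) \sum_(m < K | (n : nat) == (d * m)%N) G n).
  rewrite big_mkcond; apply: eq_bigr => n _; case: ifPn => [dvd_n|ndvd_n].
    have ltK : (n %/ d < K)%N by rewrite (leq_ltn_trans (leq_div _ _)).
    rewrite (big_pred1 (Ordinal ltK)) // => m /=.
    by rewrite -val_eqE /= eq_sym mulnC eqn_div // eq_sym.
  rewrite big_pred0 // => m; apply/negP => /eqP en.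
  by case/negP: ndvd_n; rewrite en dvdn_mulr.
rewrite (exchange_big_dep xpredT) //=; apply: eq_bigr => m _.
have [ltK|leK] := ltnP (d * m) K.
  by rewrite (big_pred1 (Ordinal ltK)) // => n; rewrite -val_eqE.
rewrite GK // big_pred0 // => n; apply/negP => /eqP en.
by have := ltn_ord n; rewrite en ltnNge leK.
Qed.

(** * Polynomial inequalities for the logarithm *)

Section LogInequalities.
Variable R : realType.
Implicit Types x y b : R.

Lemma ln_le_subr1 x : 0 < x -> ln x <= x - 1.
Proof. by move=> x_gt0; have := @le_ln1Dx R (x - 1); rewrite subrKC; apply; lra. Qed.

Lemma ln_ge_1BV x : 0 < x -> 1 - x^-1 <= ln x.
Proof.
move=> x_gt0; have := @ln_le_subr1 x^-1; rewrite invr_gt0 lnV ?posrE // => /(_ x_gt0).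
lra.
Qed.

Lemma is_derive_log_poly (p q r : {poly R}) x : -1 < x < 1 ->
  is_derive x 1 (fun t => p.[t] * ln (1 + t) + q.[t] * ln (1 - t) + r.[t])
    (p^`().[x] * ln (1 + x) + p.[x] / (1 + x)
     + (q^`().[x] * ln (1 - x) - q.[x] / (1 - x)) + r^`().[x]).
Proof.
move=> /andP[x_gt x_lt].
have ha : is_derive x 1 (fun t : R => ln (1 + t)) ((1 + x)^-1 * (0 + 1)).
  apply: (@is_derive1_comp R (@ln R) (fun t => 1 + t)).
    by apply: is_derive1_ln; lra.
have hb : is_derive x 1 (fun t : R => ln (1 - t)) ((1 - x)^-1 * (0 - 1)).
  apply: (@is_derive1_comp R (@ln R) (fun t => 1 - t)).
    by apply: is_derive1_ln; lra.
have h := is_deriveD (is_deriveD (is_deriveM (is_derive_poly p x) ha)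
  (is_deriveM (is_derive_poly q x) hb)) (is_derive_poly r x).
apply: (is_derive_eq h); rewrite /GRing.scale /=; ring.
Qed.

(** The function vanishes at 0 and has a nonnegative derivative. In most uses below the derivative
    reduces to an inequality proved just before: the quadratic forms x2logx differentiate to the
    linear forms xlogx, and those to ln(1 - x^2). *)
Lemma log_poly_ge0 (p q r : {poly R}) b : 0 <= b < 1 -> r.[0] = 0 ->
  (forall x, 0 < x < b -> 0 <= p^`().[x] * ln (1 + x) + p.[x] / (1 + x)
     + (q^`().[x] * ln (1 - x) - q.[x] / (1 - x)) + r^`().[x]) ->
  0 <= p.[b] * ln (1 + b) + q.[b] * ln (1 - b) + r.[b].
Proof.
move=> /andP[b_ge0 b_lt1] r0 df_ge0.
pose f t := p.[t] * ln (1 + t) + q.[t] * ln (1 - t) + r.[t].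
have drv x : 0 <= x <= b -> is_derive x 1 f (p^`().[x] * ln (1 + x) + p.[x] / (1 + x)
     + (q^`().[x] * ln (1 - x) - q.[x] / (1 - x)) + r^`().[x]).
  by move=> /andP[x_ge0 x_le]; apply: is_derive_log_poly; apply/andP; split; lra.
have f0 : f 0 = 0 by rewrite /f r0 subr0 !addr0 ln1 !mulr0 addr0.
rewrite -[X in X <= _]f0 -/(f b).
apply: (@ger0_derive1_le R f 0 b _ _ true false) => //.
- move=> x; rewrite in_itv /= => /andP[x_gt0 x_lt].
  by have [] := drv x ltac:(apply/andP; split; lra).
- move=> x; rewrite in_itv /= => /andP[x_gt0 x_lt]; rewrite derive1E.
  have [_ ->] := drv x ltac:(apply/andP; split; lra).
  by apply: df_ge0; rewrite x_gt0.
- apply: derivable_within_continuous => x; rewrite in_itv /= => x_itv.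
  by have [] := drv x x_itv.
- by rewrite in_itv /= lexx.
- by rewrite in_itv /= b_ge0 lexx.
Qed.

Lemma ln_midpoint b : 0 <= b < 1 -> 2 * b <= ln (1 + b) - ln (1 - b).
Proof.
move=> b_bnd; have := @log_poly_ge0 1 (-1) (- (2 *: 'X)) b b_bnd.
rewrite !(poly.derivE, hornerE) /= => /(_ ltac:(ring)) h.
suff : 0 <= ln (1 + b) + -1 * ln (1 - b) - 2 * b by lra.
apply: (le_trans (h _)) => [x /andP[x_gt0 x_lt]|]; last by lra.
rewrite !(poly.derivE, hornerE) /=.
rewrite [leRHS](_ : _ = 2 * x ^+ 2 / (1 - x ^+ 2)).
  by rewrite divr_ge0 //; nra.
by field; do ?[apply/andP; split]; apply: lt0r_neq0; nra.
Qed.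

Lemma ln_trapezoid b : 0 <= b < 1 ->
  (1 - b ^+ 2) * (ln (1 + b) - ln (1 - b)) <= 2 * b.
Proof.
move=> b_bnd; have := @log_poly_ge0 ('X^2 - 1) (1 - 'X^2) (2 *: 'X) b b_bnd.
rewrite !(poly.derivE, hornerE) /= => /(_ ltac:(ring)) h.
suff : 0 <= (b ^+ 2 - 1) * ln (1 + b) + (1 - b ^+ 2) * ln (1 - b) + 2 * b by lra.
apply: (le_trans (h _)) => [x /andP[x_gt0 x_lt]|]; last by lra.
rewrite !(poly.derivE, hornerE) /=.
have := @ln_midpoint x ltac:(apply/andP; split; lra) => {}h.
rewrite [leRHS](_ : _ = 2 * x * (ln (1 + x) - ln (1 - x))); first by nra.
by field; do ?[apply/andP; split]; apply: lt0r_neq0; nra.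
Qed.

Lemma ln_1Bsqr x : 0 <= x < 1 -> ln (1 + x) + ln (1 - x) = ln (1 - x ^+ 2).
Proof.
by move=> /andP[x_ge0 x_lt1]; rewrite -lnM ?posrE; [congr ln; ring | lra | lra].
Qed.

Lemma xlogx_even_le0 b : 0 <= b < 1 ->
  (1 + b) * ln (1 + b) - (1 - b) * ln (1 - b) <= 2 * b.
Proof.
move=> b_bnd; have := @log_poly_ge0 (- (1 + 'X)) (1 - 'X) (2 *: 'X) b b_bnd.
rewrite !(poly.derivE, hornerE) /= => /(_ ltac:(ring)) h.
suff : 0 <= - (1 + b) * ln (1 + b) + (1 - b) * ln (1 - b) + 2 * b by lra.
apply: (le_trans (h _)) => [x /andP[x_gt0 x_lt]|]; last by lra.
rewrite !(poly.derivE, hornerE) /=.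
rewrite [leRHS](_ : _ = - (ln (1 + x) + ln (1 - x))); last first.
  by field; do ?[apply/andP; split]; apply: lt0r_neq0; nra.
have := @ln_le_subr1 (1 + x) ltac:(lra); have := @ln_le_subr1 (1 - x) ltac:(lra); lra.
Qed.

(** For x <= 1/2 one has 1 / (1 - x^2) <= 1 + 4 x^2 / 3, hence ln(1 - x^2) >= -4 x^2 / 3;
    integrating gives the coefficient 4/9. *)
Lemma xlogx_even_ge b : 0 <= b <= 2^-1 ->
  2 * b - 4 / 9 * b ^+ 3 <= (1 + b) * ln (1 + b) - (1 - b) * ln (1 - b).
Proof.
move=> b_bnd.
have := @log_poly_ge0 (1 + 'X) ('X - 1) ((4 / 9) *: 'X^3 - 2 *: 'X) b
  ltac:(apply/andP; split; lra).
rewrite !(poly.derivE, hornerE) /= => /(_ ltac:(ring)) h.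
suff : 0 <= (1 + b) * ln (1 + b) + (b - 1) * ln (1 - b) + (4 / 9 * b ^+ 3 - 2 * b) by lra.
apply: (le_trans (h _)) => [x /andP[x_gt0 x_lt]|]; last by lra.
rewrite !(poly.derivE, hornerE) /=.
rewrite [leRHS](_ : _ = (ln (1 + x) + ln (1 - x)) + 4 / 3 * x ^+ 2); last first.
  by field; do ?[apply/andP; split]; apply: lt0r_neq0; nra.
rewrite ln_1Bsqr; last by apply/andP; split; lra.
have x2 : x ^+ 2 <= 4^-1 by nra.
have := @ln_ge_1BV (1 - x ^+ 2) ltac:(nra).
suff : (1 - x ^+ 2)^-1 <= 1 + 4 / 3 * x ^+ 2 by lra.
by rewrite -div1r ler_pdivrMr; nra.
Qed.

Lemma x2logx_odd_le0 b : 0 <= b < 1 ->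
  (1 + b) ^+ 2 * ln (1 + b) + (1 - b) ^+ 2 * ln (1 - b) <= 3 * b ^+ 2.
Proof.
move=> b_bnd.
have := @log_poly_ge0 (- (1 + 'X) ^+ 2) (- (1 - 'X) ^+ 2) (3 *: 'X^2) b b_bnd.
rewrite !(poly.derivE, hornerE, horner_exp) /= => /(_ ltac:(ring)) h.
suff : 0 <= - (1 + b) ^+ 2 * ln (1 + b) + - (1 - b) ^+ 2 * ln (1 - b) + 3 * b ^+ 2 by lra.
apply: (le_trans (h _)) => [x /andP[x_gt0 x_lt]|]; last by lra.
rewrite !(poly.derivE, hornerE, horner_exp) /=.
have := @xlogx_even_le0 x ltac:(apply/andP; split; lra) => {}h.
rewrite [leRHS](_ : _ = 2 * (2 * x - ((1 + x) * ln (1 + x) - (1 - x) * ln (1 - x)))).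
  by lra.
by field; do ?[apply/andP; split]; apply: lt0r_neq0; nra.
Qed.

Lemma x2logx_odd_ge b : 0 <= b <= 2^-1 ->
  3 * b ^+ 2 - 2 / 9 * b ^+ 4 <= (1 + b) ^+ 2 * ln (1 + b) + (1 - b) ^+ 2 * ln (1 - b).
Proof.
move=> b_bnd.
have := @log_poly_ge0 ((1 + 'X) ^+ 2) ((1 - 'X) ^+ 2) ((2 / 9) *: 'X^4 - 3 *: 'X^2) b
  ltac:(apply/andP; split; lra).
rewrite !(poly.derivE, hornerE, horner_exp) /= => /(_ ltac:(ring)) h.
suff : 0 <= (1 + b) ^+ 2 * ln (1 + b) + (1 - b) ^+ 2 * ln (1 - b)
    + (2 / 9 * b ^+ 4 - 3 * b ^+ 2) by lra.
apply: (le_trans (h _)) => [x /andP[x_gt0 x_lt]|]; last by lra.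
rewrite !(poly.derivE, hornerE, horner_exp) /=.
have := @xlogx_even_ge x ltac:(apply/andP; split; lra) => {}h.
rewrite [leRHS](_ : _ = 2 * ((1 + x) * ln (1 + x) - (1 - x) * ln (1 - x)
    - (2 * x - 4 / 9 * x ^+ 3))).
  by lra.
by field; do ?[apply/andP; split]; apply: lt0r_neq0; nra.
Qed.

End LogInequalities.

(** * Tents as convolutions of two intervals *)

(** The convolution of intervals of lengths A and B has a flat top only if the lengths differ by
    more than one; allowing B = A + 1 covers odd widths. *)
Lemma tent_pair_count A B n : (A <= B <= A.+1)%N ->
  (\sum_(i < A) \sum_(j < B) (n == (i + j).+1) = tent (A + B) n)%N.
Proof.
move=> AB.
have inner i : (\sum_(j < B) (n == (i + j).+1) + (i < n - B) = (i < n))%N.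
  elim: B {AB} => [|B IHB]; first by rewrite big_ord0 subn0.
  rewrite big_ord_recr /=; move: IHB; set s := (\sum_(_ < _) _)%N.
  by case: eqP; lia.
have : (\sum_(i < A) \sum_(j < B) (n == (i + j).+1) + \sum_(i < A) (i < n - B)
    = \sum_(i < A) (i < n))%N.
  by rewrite -big_split; apply: eq_bigr => i _; exact: inner.
by rewrite !sum_ltn_ord /tent; lia.
Qed.

Lemma sum_tent_pairs (V : nmodType) (F : nat -> V) K A B :
  (A <= B <= A.+1)%N -> (A + B <= K)%N ->
  \sum_(n < K) F n *+ tent (A + B) n = \sum_(i < A) \sum_(j < B) F (i + j).+1.
Proof.
move=> AB leK.
under eq_bigr => n _ do rewrite -(@tent_pair_count A B n AB).
under eq_bigr => n _.
  rewrite -sumrMnr; under eq_bigr => i _ do rewrite -sumrMnr.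
  over.
rewrite exchange_big /=; apply: eq_bigr => i _.
rewrite exchange_big /=; apply: eq_bigr => j _.
have ltK : ((i + j).+1 < K)%N by have := ltn_ord i; have := ltn_ord j; lia.
rewrite (bigD1 (Ordinal ltK)) //= eqxx big1 ?addr0 // => n ne_n.
by case: eqP => // en; case/eqP: ne_n; apply: val_inj.
Qed.

Lemma sum_second_difference (V : zmodType) (u : nat -> V) A B :
  \sum_(i < A) \sum_(j < B) (u (i + j).+2 - u (i + j).+1 - (u (i + j).+1 - u (i + j)%N))
  = u (A + B)%N - u A - u B + u 0%N.
Proof.
have inner i : \sum_(j < B) (u (i + j).+2 - u (i + j).+1 - (u (i + j).+1 - u (i + j)%N))
    = u (i.+1 + B)%N - u (i + B)%N - (u i.+1 - u i).
  pose f k := u (i + k).+1 - u (i + k)%N.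
  rewrite -(big_mkord xpredT (fun j => u (i + j).+2 - u (i + j).+1 -
    (u (i + j).+1 - u (i + j)%N))).
  under eq_bigr => j _ do rewrite -[u (i + j).+1 - u (i + j)%N]/(f j) -addnS -/(f j.+1).
  by rewrite telescope_sumr // /f addn0.
under eq_bigr => i _ do rewrite inner.
rewrite big_split /= sumrN.
rewrite -(big_mkord xpredT (fun i => u (i.+1 + B)%N - u (i + B)%N)).
rewrite -(big_mkord xpredT (fun i => u i.+1 - u i)) telescope_sumr //.
rewrite (@telescope_sumr _ 0 A u) // add0n opprB addrA addrAC -!addrA; congr (_ + _).
by rewrite addrCA addrC -!addrA.
Qed.

(** * Differences of logarithms and numerical values *)

Section LogSums.
Variable R : realType.
Implicit Types x y a b : R.

Lemma lnS_ge (k : nat) : (0 < k)%N -> 2 / (2 * k%:R + 1) <= ln k.+1%:R - ln (k%:R : R).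
Proof.
move=> k_gt0; have kR : 0 < (k%:R : R) by rewrite ltr0n.
(* Chosen so that (1 + b) / (1 - b) = (k + 1) / k. *)
pose b : R := (2 * k%:R + 1)^-1.
have b_gt0 : 0 < b by rewrite invr_gt0; lra.
have eb : b * (2 * k%:R + 1) = 1 by rewrite mulVf //; apply: lt0r_neq0; lra.
have b_lt1 : b < 1 by rewrite invf_lt1; lra.
have := @ln_midpoint R b ltac:(apply/andP; split; lra).
rewrite -ln_div ?posrE; [|lra|lra].
rewrite -(@ln_div _ k.+1%:R) ?posrE ?ltr0n //.
rewrite (_ : (1 + b) / (1 - b) = k.+1%:R / k%:R) // -natr1.
rewrite /b; field; rewrite ?lt0r_neq0 //=; lra.
Qed.

Lemma lnS_le (k : nat) : (0 < k)%N ->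
  ln k.+1%:R - ln (k%:R : R) <= (k%:R^-1 + k.+1%:R^-1) / 2.
Proof.
move=> k_gt0; have kR : 0 < (k%:R : R) by rewrite ltr0n.
pose b : R := (2 * k%:R + 1)^-1.
have b_gt0 : 0 < b by rewrite invr_gt0; lra.
have b_lt1 : b < 1 by rewrite invf_lt1; lra.
have := @ln_trapezoid R b ltac:(apply/andP; split; lra).
rewrite -ln_div ?posrE; [|lra|lra].
rewrite -(@ln_div _ k.+1%:R) ?posrE ?ltr0n //.
rewrite (_ : (1 + b) / (1 - b) = k.+1%:R / k%:R); last first.
  by rewrite -natr1 /b; field; rewrite ?lt0r_neq0 //=; lra.
rewrite -ler_pdivlMl; last by nra.
move=> /le_trans; apply; rewrite le_eqVlt; apply/orP; left; apply/eqP.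
rewrite -natr1 /b; field; rewrite ?lt0r_neq0 //=; try lra; nra.
Qed.

(** The second primitive of ln: its derivative is x ln x - x. *)
Definition logquad x := x ^+ 2 / 2 * (ln x - 3 / 2).

Lemma logquad_tangent a b : 0 < a -> 0 < b ->
  logquad b = logquad a + (a * ln a - a) * (b - a) + (b - a) ^+ 2 / 2 * (ln a - 3 / 2)
    + a ^+ 2 / 2 * ((b / a) ^+ 2 * ln (b / a) - (b / a - 1)).
Proof.
move=> a_gt0 b_gt0; rewrite ln_div ?posrE // /logquad; field.
by rewrite ?lt0r_neq0.
Qed.

Lemma logquad_ge a b : 0 < a -> 0 < b ->
  logquad a + (a * ln a - a) * (b - a) + (b - a) ^+ 2 / 2 * (ln a - 1 / 2) <= logquad b.
Proof.
move=> a_gt0 b_gt0; rewrite [leRHS](logquad_tangent a_gt0) //.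
have x_gt0 : 0 < b / a by rewrite divr_gt0.
have h := @ln_ge_1BV R (b / a) x_gt0.
have eb : b = (b / a) * a by rewrite divfK // lt0r_neq0.
set x := b / a in x_gt0 h eb *; clearbody x; subst b.
have h2 : x ^+ 2 - x <= x ^+ 2 * ln x.
  rewrite (_ : x ^+ 2 - x = x ^+ 2 * (1 - x^-1)); last by field; rewrite lt0r_neq0.
  by rewrite ler_wpM2l // exprn_ge0 // ltW.
suff : a ^+ 2 / 2 * (x - 1) ^+ 2 <= a ^+ 2 / 2 * (x ^+ 2 * ln x - (x - 1)).
  by lra.
by rewrite ler_wpM2l //; nra.
Qed.

Lemma logquad_le a b : 0 < a -> 0 < b ->
  logquad b <= logquad a + (a * ln a - a) * (b - a)
    + (b - a) ^+ 2 / 2 * (ln a - 1 / 2 + b / a).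
Proof.
move=> a_gt0 b_gt0; rewrite [leLHS](logquad_tangent a_gt0) //.
have x_gt0 : 0 < b / a by rewrite divr_gt0.
have h := @ln_le_subr1 R (b / a) x_gt0.
have eb : b = (b / a) * a by rewrite divfK // lt0r_neq0.
set x := b / a in x_gt0 h eb *; clearbody x; subst b.
have h2 : x ^+ 2 * ln x <= x ^+ 2 * (x - 1) by rewrite ler_wpM2l // exprn_ge0 // ltW.
suff : a ^+ 2 / 2 * (x ^+ 2 * ln x - (x - 1)) <= a ^+ 2 / 2 * ((x - 1) ^+ 2 * (x + 1)).
  by lra.
by rewrite ler_wpM2l //; nra.
Qed.
End LogSums.

Section LogSums2.
Variable R : realType.
Implicit Types x y a b : R.

Lemma ln_natM (m n : nat) : (0 < m)%N -> (0 < n)%N ->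
  ln ((m * n)%:R : R) = ln m%:R + ln n%:R.
Proof. by move=> m0 n0; rewrite natrM lnM ?posrE ?ltr0n. Qed.

(** The bounds on ln(k + 1) - ln k for 16 <= k < 32, with the factorisations of 16, 20, 22, 24, 26,
    28 and 32, form a linear system; ln 2 = ln 32 - ln 16 uses the whole chain. *)
Lemma ln_small_bounds :
  [/\ 9 / 13 <= ln (2 : R) <= 43 / 62,
      45 / 41 <= ln (3 : R) <= 11 / 10,
      127 / 79 <= ln (5 : R) <= 124 / 77
    & 208 / 107 <= ln (7 : R) <= 37 / 19] /\
  [/\ ln (11 : R) <= 12 / 5, ln (13 : R) <= 77 / 30, ln (17 : R) <= 309 / 109 & ln (19 : R) <= 274 / 93].
Proof.
pose l k := ln (k%:R : R).
have lo k : (0 < k)%N -> 2 <= (l k.+1 - l k) * (2 * k%:R + 1).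
  by move=> k_gt0; rewrite -ler_pdivrMr ?lnS_ge // ltr_wpDl // mulr_ge0.
have up k : (0 < k)%N -> (l k.+1 - l k) * (2 * k%:R * (k%:R + 1)) <= 2 * k%:R + 1.
  move=> k_gt0; have kR : 0 < (k%:R : R) by rewrite ltr0n.
  rewrite -ler_pdivlMr; last by rewrite !mulr_gt0 //; lra.
  apply: le_trans (lnS_le R k_gt0) _; rewrite -natr1 le_eqVlt; apply/orP; left.
  by apply/eqP; field; rewrite ?lt0r_neq0 //=; lra.
have e4 : l 4%N = l 2%N + l 2%N by exact: (@ln_natM 2 2).
have e8 : l 8%N = l 2%N + l 4%N by exact: (@ln_natM 2 4).
have e16 : l 16%N = l 2%N + l 8%N by exact: (@ln_natM 2 8).
have e32 : l 32%N = l 2%N + l 16%N by exact: (@ln_natM 2 16).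
have e24 : l 24%N = l 3%N + l 8%N by exact: (@ln_natM 3 8).
have e20 : l 20%N = l 5%N + l 4%N by exact: (@ln_natM 5 4).
have e28 : l 28%N = l 7%N + l 4%N by exact: (@ln_natM 7 4).
have e22 : l 22%N = l 11%N + l 2%N by exact: (@ln_natM 11 2).
have e26 : l 26%N = l 13%N + l 2%N by exact: (@ln_natM 13 2).
have l2lo : 9 / 13 <= l 2%N.
  by have := lo 16%N isT; have := lo 17%N isT; have := lo 18%N isT; have := lo 19%N isT; have := lo 20%N isT; have := lo 21%N isT; have := lo 22%N isT; have := lo 23%N isT; have := lo 24%N isT; have := lo 25%N isT; have := lo 26%N isT; have := lo 27%N isT; have := lo 28%N isT; have := lo 29%N isT; have := lo 30%N isT; have := lo 31%N isT; lra.
have l2up : l 2%N <= 43 / 62.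
  by have := up 16%N isT; have := up 17%N isT; have := up 18%N isT; have := up 19%N isT; have := up 20%N isT; have := up 21%N isT; have := up 22%N isT; have := up 23%N isT; have := up 24%N isT; have := up 25%N isT; have := up 26%N isT; have := up 27%N isT; have := up 28%N isT; have := up 29%N isT; have := up 30%N isT; have := up 31%N isT; lra.
have l3lo : 45 / 41 <= l 3%N by have := lo 16%N isT; have := lo 17%N isT; have := lo 18%N isT; have := lo 19%N isT; have := lo 20%N isT; have := lo 21%N isT; have := lo 22%N isT; have := lo 23%N isT; lra.
have l5lo : 127 / 79 <= l 5%N by have := lo 16%N isT; have := lo 17%N isT; have := lo 18%N isT; have := lo 19%N isT; lra.
have l7lo : 208 / 107 <= l 7%N by have := lo 16%N isT; have := lo 17%N isT; have := lo 18%N isT; have := lo 19%N isT; have := lo 20%N isT; have := lo 21%N isT; have := lo 22%N isT; have := lo 23%N isT; have := lo 24%N isT; have := lo 25%N isT; have := lo 26%N isT; have := lo 27%N isT; lra.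
have l3up : l 3%N <= 11 / 10 by have := up 16%N isT; have := up 17%N isT; have := up 18%N isT; have := up 19%N isT; have := up 20%N isT; have := up 21%N isT; have := up 22%N isT; have := up 23%N isT; lra.
have l5up : l 5%N <= 124 / 77 by have := up 16%N isT; have := up 17%N isT; have := up 18%N isT; have := up 19%N isT; lra.
have l7up : l 7%N <= 37 / 19 by have := up 16%N isT; have := up 17%N isT; have := up 18%N isT; have := up 19%N isT; have := up 20%N isT; have := up 21%N isT; have := up 22%N isT; have := up 23%N isT; have := up 24%N isT; have := up 25%N isT; have := up 26%N isT; have := up 27%N isT; lra.
have l11up : l 11%N <= 12 / 5 by have := up 16%N isT; have := up 17%N isT; have := up 18%N isT; have := up 19%N isT; have := up 20%N isT; have := up 21%N isT; lra.
have l13up : l 13%N <= 77 / 30 by have := up 16%N isT; have := up 17%N isT; have := up 18%N isT; have := up 19%N isT; have := up 20%N isT; have := up 21%N isT; have := up 22%N isT; have := up 23%N isT; have := up 24%N isT; have := up 25%N isT; lra.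
have l17up : l 17%N <= 309 / 109 by have := up 16%N isT; lra.
have l19up : l 19%N <= 274 / 93 by have := up 16%N isT; have := up 17%N isT; have := up 18%N isT; lra.
by split; split => //; apply/andP; split.
Qed.
End LogSums2.

(** * Sums of the logarithm against a tent *)

Section TentLogSums.
Variable R : realType.
Implicit Types x y a b : R.

Let u (n : nat) : R := logquad n%:R.

Lemma ln2_bounds : 9 / 13 <= ln (2 : R) <= 43 / 62.
Proof. by have [[]] := ln_small_bounds R. Qed.

Let u0 : u 0%N = 0.
Proof. by rewrite /u /logquad expr0n /= mul0r mul0r. Qed.

Let second_differenceE (k : nat) : (0 < k)%N ->
  let x := (k.+1%:R : R)^-1 in
  u k.+2 - u k.+1 - (u k.+1 - u k) = ln k.+1%:R - 3 / 2
    + k.+1%:R ^+ 2 / 2 * ((1 + x) ^+ 2 * ln (1 + x) + (1 - x) ^+ 2 * ln (1 - x)).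
Proof.
move=> k_gt0 /=; have kR : 0 < (k%:R : R) by rewrite ltr0n.
have n_gt0 : 0 < (k.+1%:R : R) by rewrite ltr0n.
have n_gt1 : 1 < (k.+1%:R : R) by rewrite ltr1n ltnS.
have e1 : 1 + k.+1%:R^-1 = k.+2%:R / k.+1%:R :> R.
  by rewrite -[k.+2%:R]natr1; field; rewrite lt0r_neq0.
have e2 : 1 - k.+1%:R^-1 = k%:R / k.+1%:R :> R.
  by rewrite -natr1; field; rewrite natr1 lt0r_neq0.
rewrite e1 e2 !ln_div ?posrE ?ltr0n // /u /logquad.
rewrite -[k.+2%:R]natr1 -natr1; field.
by rewrite natr1 lt0r_neq0.
Qed.

Lemma second_difference_le (k : nat) : u k.+2 - u k.+1 - (u k.+1 - u k) <= ln k.+1%:R.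
Proof.
have /andP[_ ln2] := ln2_bounds.
case: k => [|k]; first by rewrite u0 /u /logquad ln1; lra.
rewrite second_differenceE //; set x := k.+2%:R^-1; set n : R := k.+2%:R.
have n_gt1 : 1 < n by rewrite ltr1n.
have x_gt0 : 0 < x by rewrite invr_gt0; lra.
have x_lt1 : x < 1 by rewrite invf_lt1; lra.
have nx : n * x = 1 by rewrite mulfV // lt0r_neq0 //; lra.
have := @x2logx_odd_le0 R x ltac:(apply/andP; split; lra).
set T := _ + _ => hT.
have : n ^+ 2 / 2 * T <= n ^+ 2 / 2 * (3 * x ^+ 2) by rewrite ler_wpM2l //; nra.
have -> : n ^+ 2 / 2 * (3 * x ^+ 2) = 3 / 2 * (n * x) ^+ 2 by ring.
by rewrite nx; lra.
Qed.

(** For k > 0 the expansion would allow 1/9 in place of 1/8. The constant 8 is dictated by k = 0,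
    where the second difference is 2 ln 2 - 3/2. *)
Lemma second_difference_ge (k : nat) :
  ln k.+1%:R - (8 * k.+1%:R ^+ 2)^-1 <= u k.+2 - u k.+1 - (u k.+1 - u k).
Proof.
have /andP[ln2 _] := ln2_bounds.
case: k => [|k]; first by rewrite u0 /u /logquad ln1; lra.
rewrite second_differenceE //; set x := k.+2%:R^-1; set n : R := k.+2%:R.
have n_ge2 : 2 <= n by rewrite ler_nat.
have x_gt0 : 0 < x by rewrite invr_gt0; lra.
have x_le : x <= 2^-1 by rewrite lef_pV2 ?posrE; lra.
have nx : n * x = 1 by rewrite mulfV // lt0r_neq0 //; lra.
have := @x2logx_odd_ge R x ltac:(apply/andP; split; lra).
set T := (1 + x) ^+ 2 * _ + _ => hT.
have : n ^+ 2 / 2 * (3 * x ^+ 2 - 2 / 9 * x ^+ 4) <= n ^+ 2 / 2 * T.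
  by rewrite ler_wpM2l //; nra.
have -> : n ^+ 2 / 2 * (3 * x ^+ 2 - 2 / 9 * x ^+ 4)
  = 3 / 2 * (n * x) ^+ 2 - 1 / 9 * (n * x) ^+ 2 * x ^+ 2 by field.
have -> : (8 * n ^+ 2)^-1 = x ^+ 2 / 8 by rewrite invfM exprVn mulrC.
by rewrite nx; have := sqr_ge0 x; lra.
Qed.

Lemma harmonic_le n : (0 < n)%N -> \sum_(0 <= k < n) (k.+1%:R : R)^-1 <= 1 + ln n%:R.
Proof.
case: n => // n _; elim: n => [|n IHn]; first by rewrite big_nat1 ln1 invr1 addr0.
have n_gt0 : 0 < (n.+1%:R : R) by rewrite ltr0n.
have h : (n.+2%:R : R)^-1 <= ln n.+2%:R - ln n.+1%:R.
  apply: le_trans (@lnS_ge R n.+1 isT); rewrite -[n.+2%:R]natr1 -div1r.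
  by rewrite ler_pdivrMr ?ltr_wpDr // mulrAC ler_pdivlMr; lra.
by rewrite big_nat_recr //=; apply: le_trans (lerD IHn h) _; lra.
Qed.

Definition tent_log K N : R := \sum_(n < K) ln n%:R *+ tent N n.

(** By the convolution form, the tent sum is a sum of ln over an A by B rectangle. Replacing ln by
    the second difference of its second primitive makes this double sum telescope to the corners. *)
Lemma tent_log_lb_split K A B : (A <= B <= A.+1)%N -> (A + B <= K)%N ->
  u (A + B)%N - u A - u B <= tent_log K (A + B).
Proof.
move=> AB leK; rewrite /tent_log (sum_tent_pairs (fun n => ln (n%:R : R))) //.
have -> : u (A + B)%N - u A - u B = u (A + B)%N - u A - u B + u 0%N by rewrite u0 addr0.
rewrite -sum_second_difference.
by do 2![apply: ler_sum => ? _]; exact: second_difference_le.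
Qed.

(** The loss 1 / (8 n^2) at each n, weighted by a tent of height at most n, adds up to an eighth of
    a harmonic sum. *)
Lemma tent_log_ub_split K A B : (A <= B <= A.+1)%N -> (0 < A + B <= K)%N ->
  tent_log K (A + B) <= u (A + B)%N - u A - u B + (1 + ln (A + B)%:R) / 8.
Proof.
move=> AB /andP[AB_gt0 leK].
have -> : u (A + B)%N - u A - u B = u (A + B)%N - u A - u B + u 0%N by rewrite u0 addr0.
rewrite -sum_second_difference.
pose F n : R := (8 * n%:R ^+ 2)^-1.
have h : \sum_(n < K) F n *+ tent (A + B) n <= (1 + ln (A + B)%:R) / 8.
  apply: (@le_trans _ _ ((\sum_(0 <= k < A + B) (k.+1%:R : R)^-1) / 8)); last first.
    by have := harmonic_le AB_gt0; lra.
  rewrite mulr_suml -(big_mkord xpredT (fun n => F n *+ tent (A + B) n)).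
  rewrite (big_cat_nat (leq0n (A + B)) leK) /= [X in _ + X]big_nat_cond.
  rewrite [X in _ + X]big1 ?addr0 => [|n /andP[/andP[le_n _] _]]; last first.
    by rewrite tent_eq0.
  case eN : (A + B)%N AB_gt0 => [//|N'] _; rewrite big_nat_recl // tent0 mulr0n add0r.
  rewrite [leRHS]big_nat_recr //=.
  apply: (@le_trans _ _ (\sum_(0 <= i < N') (i.+1%:R : R)^-1 / 8)); last first.
    by rewrite lerDl divr_ge0 // invr_ge0.
  apply: ler_sum => n _; rewrite -[F n.+1 *+ _]mulr_natr.
  have n_gt0 : 0 < (n.+1%:R : R) by rewrite ltr0n.
  rewrite (_ : n.+1%:R^-1 / 8 = F n.+1 * n.+1%:R); last first.
    by rewrite /F; field; rewrite lt0r_neq0.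
  rewrite ler_wpM2l ?ler_nat ?tent_le //.
  by rewrite /F invr_ge0 mulr_ge0 // exprn_ge0 // ltW.
rewrite (sum_tent_pairs F) // in h; rewrite /tent_log (sum_tent_pairs (fun n => ln (n%:R : R))) //.
apply: le_trans (lerD (lexx _) h); rewrite -big_split /=; apply: ler_sum => i _.
rewrite -big_split /=; apply: ler_sum => j _.
by have := second_difference_ge (i + j); rewrite -/(F _); lra.
Qed.

(** The integral of ln against the tent of real width y, that is, [logquad] at y minus twice its
    value at y / 2. *)
Definition tent_log_main y : R := y ^+ 2 / 4 * (ln y + ln 2 - 3 / 2).

Let tent_log_mainE n : (0 < n)%N ->
  tent_log_main n%:R = u n - 2 * logquad (n%:R / 2).
Proof.
move=> n_gt0; have h : ln (n%:R / 2) = ln (n%:R : R) - ln 2 by rewrite ln_div ?posrE ?ltr0n.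
by rewrite /tent_log_main /u /logquad h; lra.
Qed.

(** For odd N the halves are N/2 - 1/2 and N/2 + 1/2, and the second order term of [logquad] costs
    (ln(N/2) + 1/2) / 4, which is below (ln N) / 4. *)
Lemma tent_log_ge K N : (0 < N <= K)%N ->
  tent_log_main N%:R - ln N%:R / 4 <= tent_log K N.
Proof.
move=> /andP[N_gt0 leK]; have /andP[ln2lo ln2up] := ln2_bounds.
have lnN : 0 <= ln (N%:R : R) by rewrite ln_ge0 // ler1n.
have [eN|N_gt1] := leqP N 1.
  have -> : N = 1%N by lia.
  rewrite /tent_log /tent_log_main big1 => [|n _]; first by rewrite ln1; lra.
  by rewrite (_ : tent 1 n = 0%N) // /tent; lia.
have eAB : N = (N./2 + (N - N./2))%N by lia.
have := @tent_log_lb_split K N./2 (N - N./2).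
rewrite -eAB => /(_ ltac:(lia) leK).
apply: le_trans; rewrite tent_log_mainE //.
have A_gt0 : 0 < ((N./2)%:R : R) by rewrite ltr0n; lia.
have B_gt0 : 0 < ((N - N./2)%:R : R) by rewrite ltr0n; lia.
have NR : 1 < (N%:R : R) by rewrite ltr1n.
have hA := @logquad_le R (N%:R / 2) (N./2)%:R ltac:(lra) A_gt0.
have hB := @logquad_le R (N%:R / 2) (N - N./2)%:R ltac:(lra) B_gt0.
have eR : N%:R = (N./2)%:R + (N - N./2)%:R :> R by rewrite -natrD -eAB.
have ln_half : ln (N%:R / 2) = ln (N%:R : R) - ln 2 by rewrite ln_div ?posrE //; lra.
rewrite ln_half in hA hB; rewrite /u.
have [eAB2|eAB2] : (N - N./2 = N./2)%N \/ (N - N./2 = (N./2).+1)%N by lia.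
  rewrite eAB2 in eR *; have -> : N%:R / 2 = (N./2)%:R :> R by lra.
  lra.
rewrite eAB2 -natr1 in eR hB *.
have eA : (N./2)%:R = N%:R / 2 - 1 / 2 :> R by lra.
rewrite eA in hA hB *; set a := N%:R / 2 in hA hB *.
have a_gt0 : 0 < a by rewrite /a; lra.
have e1 : (a - 1 / 2) / a = 1 - (2 * a)^-1 by field; rewrite lt0r_neq0.
have e2 : (a - 1 / 2 + 1) / a = 1 + (2 * a)^-1 by field; rewrite lt0r_neq0.
by rewrite e1 in hA; rewrite e2 in hB; lra.
Qed.

Lemma tent_log_le K N : (3 < N <= K)%N ->
  tent_log K N <= tent_log_main N%:R + (1 + ln N%:R) / 8.
Proof.
move=> /andP[N_gt3 leK]; have /andP[ln2lo ln2up] := ln2_bounds.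
have eAB : N = (N./2 + (N - N./2))%N by lia.
have := @tent_log_ub_split K N./2 (N - N./2).
rewrite -eAB => /(_ ltac:(lia) ltac:(lia)).
move=> /le_trans; apply; rewrite tent_log_mainE; last by lia.
have A_gt0 : 0 < ((N./2)%:R : R) by rewrite ltr0n; lia.
have B_gt0 : 0 < ((N - N./2)%:R : R) by rewrite ltr0n; lia.
have NR : 4 <= (N%:R : R) by rewrite ler_nat.
have hA := @logquad_ge R (N%:R / 2) (N./2)%:R ltac:(lra) A_gt0.
have hB := @logquad_ge R (N%:R / 2) (N - N./2)%:R ltac:(lra) B_gt0.
have eR : N%:R = (N./2)%:R + (N - N./2)%:R :> R by rewrite -natrD -eAB.
have ln_half : ln 2 <= ln (N%:R / 2 : R) by rewrite ler_ln ?posrE; lra.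
have sq x : 0 <= x ^+ 2 / 2 * (ln (N%:R / 2) - 1 / 2).
  by rewrite mulr_ge0 // ?divr_ge0 ?sqr_ge0 //; lra.
have hA2 := sq ((N./2)%:R - N%:R / 2); have hB2 := sq ((N - N./2)%:R - N%:R / 2).
rewrite /u; set a := N%:R / 2 in hA hB hA2 hB2 *; set A := (N./2)%:R in hA hA2 eR *.
set B := (N - N./2)%:R in hB hB2 eR *.
have eB : B - a = - (A - a) by rewrite /a; lra.
by rewrite eB in hB hB2; lra.
Qed.

(** Convexity at i + rho / j, with the weights of [tent_interpolate], so that a fractional width N /
    j costs nothing in the main term. It is proved by the tangent at y. *)
Lemma tent_log_main_convex (i j rho : nat) : (0 < i)%N -> (0 < j)%N -> (rho <= j)%N ->
  j%:R * tent_log_main ((i * j + rho)%:R / j%:R)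
  <= (j - rho)%:R * tent_log_main i%:R + rho%:R * tent_log_main i.+1%:R.
Proof.
move=> i_gt0 j_gt0 le_rho; have /andP[ln2lo ln2up] := ln2_bounds.
have iR : 1 <= (i%:R : R) by rewrite ler1n.
have jR : 0 < (j%:R : R) by rewrite ltr0n.
have rR : 0 <= (rho%:R : R) by [].
have rjR : rho%:R <= (j%:R : R) by rewrite ler_nat.
set y : R := _ / _.
have ey : y = i%:R + rho%:R / j%:R by rewrite /y natrD natrM; field; rewrite lt0r_neq0.
have y_ge1 : 1 <= y by rewrite ey -[leLHS]addr0 lerD // divr_ge0 // ltW.
have ln_y : 0 <= ln y by rewrite ln_ge0.
have mainE x : tent_log_main x = logquad x / 2 + ln 2 / 4 * x ^+ 2.
  by rewrite /tent_log_main /logquad; field.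
have tangent b : 0 < b -> tent_log_main y + ((y * ln y - y) / 2 + ln 2 / 2 * y) * (b - y)
    <= tent_log_main b.
  move=> b_gt0; have := @logquad_ge R y b ltac:(lra) b_gt0; rewrite !mainE => h.
  have : 0 <= (b - y) ^+ 2 * (ln y - 1 / 2 + ln 2) by rewrite mulr_ge0 ?sqr_ge0 //; lra.
  by nra.
have h1 := tangent i%:R ltac:(lra).
have h2 := tangent i.+1%:R ltac:(rewrite -natr1; lra).
have s1 : 0 <= ((j - rho)%:R : R) by [].
have := lerD (ler_wpM2l s1 h1) (ler_wpM2l rR h2); apply: le_trans.
rewrite natrB // -[i.+1%:R]natr1.
have ejy : j%:R * y = i%:R * j%:R + rho%:R.
  by rewrite /y natrD natrM mulrC divfK // lt0r_neq0.
set T := tent_log_main y; set S := (y * ln y - y) / 2 + _.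
have -> : (j%:R - rho%:R) * (T + S * (i%:R - y)) + rho%:R * (T + S * (i%:R + 1 - y))
  = j%:R * T + S * (i%:R * j%:R + rho%:R - j%:R * y) by ring.
by rewrite ejy subrr mulr0 addr0.
Qed.
End TentLogSums.

(** * A Chebyshev bound for sums of Lambda against a tent *)

Section TentChebyshev.
Variable R : realType.
Implicit Types x y a b : R.

Lemma sum_tent_interpolate (F : nat -> R) K N m rho : (rho <= m)%N ->
  \sum_(n < K) F n *+ tent (N * m + rho) (n * m) =
  (m - rho)%:R * (\sum_(n < K) F n *+ tent N n) + rho%:R * (\sum_(n < K) F n *+ tent N.+1 n).
Proof.
move=> le_rho; rewrite !mulr_sumr -big_split; apply: eq_bigr => n _ /=.
by rewrite tent_interpolate // mulrnDr !mulr_natl -!mulrnA ![(_ * tent _ _)%N]mulnC.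
Qed.

Lemma sum_tent_widen (F : nat -> R) K N m : (N <= K)%N -> (0 < m)%N ->
  \sum_(n < K) F n *+ tent N (n * m) = \sum_(n < N) F n *+ tent N (n * m).
Proof.
move=> leNK m_gt0; rewrite -!(big_mkord xpredT (fun n => F n *+ tent N (n * m))).
rewrite (big_cat_nat (leq0n N) leNK) /= -[RHS]addr0; congr (_ + _).
rewrite big_nat_cond big1 // => i; rewrite andbT => /andP[leNi _].
by rewrite tent_eq0 //; nia.
Qed.

(** Interpolation between the widths i and i + 1 goes the right way twice: the main term is convex,
    and the subtracted error, a multiple of ln, is concave. *)
Lemma tent_log_multiples_ge K N j : (1 < j <= N)%N -> (N <= K)%N ->
  j%:R * tent_log_main (N%:R / j%:R) - j%:R / 4 * ln (N%:R / j%:R)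
  <= \sum_(n < K) ln (n%:R : R) *+ tent N (n * j).
Proof.
move=> /andP[j_gt1 lejN] leNK; have j_gt0 : (0 < j)%N by lia.
have eN := divn_eq N j; have lt_rho := ltn_pmod N j_gt0.
set i := (N %/ j)%N in eN; set rho := (N %% j)%N in eN lt_rho.
have i_gt0 : (0 < i)%N by rewrite divn_gt0.
rewrite [leRHS](_ : _ = \sum_(n < K) ln (n%:R : R) *+ tent (i * j + rho) (n * j)); last by rewrite -eN.
rewrite (sum_tent_interpolate (fun n => ln (n%:R : R))); last exact: ltnW.
have h := @tent_log_main_convex R i j rho i_gt0 j_gt0 (ltnW lt_rho).
rewrite -eN in h.
have h1 := @tent_log_ge R K i ltac:(nia).
have h2 := @tent_log_ge R K i.+1 ltac:(nia).
have jR : 0 < (j%:R : R) by rewrite ltr0n.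
have iR : 0 < (i%:R : R) by rewrite ltr0n.
have NR : 0 < (N%:R : R) by rewrite ltr0n; lia.
set y : R := N%:R / j%:R in h *.
have y_gt0 : 0 < y by rewrite divr_gt0.
have ejy : j%:R * y = i%:R * j%:R + rho%:R.
  by rewrite /y eN natrD natrM mulrC divfK // lt0r_neq0.
have tangent b : 0 < b -> ln b <= ln y + (b / y - 1).
  move=> b_gt0; have := @ln_le_subr1 R (b / y) (divr_gt0 b_gt0 y_gt0).
  by rewrite ln_div ?posrE //; lra.
have l1 := tangent i%:R iR; have l2 := tangent i.+1%:R ltac:(rewrite ltr0n; lia).
have s1 : 0 <= ((j - rho)%:R : R) by []; have s2 : 0 <= (rho%:R : R) by [].
have concave : (j - rho)%:R * ln i%:R + rho%:R * ln i.+1%:R <= j%:R * ln y.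
  apply: le_trans (lerD (ler_wpM2l s1 l1) (ler_wpM2l s2 l2)) _.
  rewrite natrB ?(ltnW lt_rho) // -[i.+1%:R]natr1.
  have -> : (j%:R - rho%:R) * (ln y + (i%:R / y - 1)) + rho%:R * (ln y + ((i%:R + 1) / y - 1))
    = j%:R * ln y + ((i%:R * j%:R + rho%:R) - j%:R * y) / y by field; rewrite lt0r_neq0.
  by rewrite ejy subrr mul0r addr0.
apply: le_trans (lerD (ler_wpM2l s1 h1) (ler_wpM2l s2 h2)).
by lra.
Qed.

Definition tent_psi K N : R := \sum_(d < K) vonMangoldt R d *+ tent N d.

Lemma sum_vonMangoldt_tent_sum K N j : (0 < j)%N -> (N <= K)%N ->
  \sum_(d < K) vonMangoldt R d *+ tent_sum K N (d * j)
  = \sum_(n < K) ln (n%:R : R) *+ tent N (n * j).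
Proof.
move=> j_gt0 leNK.
have := @sum_ln_vonMangoldt R K (fun n => (tent N (n * j))%:R).
rewrite mul0n tent0 => /(_ erefl) h.
under [RHS]eq_bigr => n _ do rewrite -[_ *+ tent _ _]mulr_natr.
rewrite h => [|n leKn]; last by rewrite tent_eq0 //; nia.
apply: eq_bigr => d _; rewrite -[_ *+ tent_sum _ _ _]mulr_natr -natr_sum /tent_sum; congr (_ * _%:R).
by apply: eq_bigr => m _; rewrite mulnAC.
Qed.

Lemma tent_psi_kernel K N : (N <= K)%N ->
  tent_psi K N <= tent_log R K N - \sum_(n < K) ln (n%:R : R) *+ tent N (n * 2)
    - \sum_(n < K) ln (n%:R : R) *+ tent N (n * 3)
    - \sum_(n < K) ln (n%:R : R) *+ tent N (n * 6)
    + (\sum_(d < K) vonMangoldt R d *+ tent N (d * 6)) / 5.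
Proof.
move=> leNK.
have -> : tent_log R K N = \sum_(n < K) ln (n%:R : R) *+ tent N (n * 1).
  by apply: eq_bigr => n _; rewrite muln1.
rewrite -!sum_vonMangoldt_tent_sum // mulr_suml -!sumrB -big_split /=.
apply: ler_sum => d _; have [->|d_gt0] := posnP d.
  by rewrite vonMangoldt0 !mul0rn !subr0 mul0r addr0.
have := @tent_kernel K N d d_gt0 leNK.
rewrite muln1 ![(d * _)%N]mulnC -(ler_nat R) !natrD => h.
have := ler_wpM2l (vonMangoldt_ge0 R d) h.
rewrite -![vonMangoldt R d *+ _]mulr_natr.
by lra.
Qed.

Lemma tent_psi_small K N : (2 < N < 24)%N -> (N <= K)%N ->
  tent_psi K N <= 11 / 40 * (N%:R ^+ 2 - 19 / 4).
Proof.
move=> /andP[N_gt2 N_lt24] leNK; have [[l2 l3 l5 l7] [l11 l13 l17 l19]] := ln_small_bounds R.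
have -> : tent_psi K N = \sum_(d < N) vonMangoldt R d *+ tent N d.
  transitivity (\sum_(d < K) vonMangoldt R d *+ tent N (d * 1)).
    by apply: eq_bigr => d _; rewrite muln1.
  by rewrite sum_tent_widen //; apply: eq_bigr => d _; rewrite muln1.
(* Upper bounds of 20 * vonMangoldt d. *)
pose ub := nth 0%N [:: 0; 0; 14; 22; 14; 33; 0; 39; 14; 22; 0; 48; 0; 52; 0; 0; 14; 57; 0; 59;
  0; 0; 0]%N.
have ubP d : (d < 23)%N -> vonMangoldt R d <= (ub d)%:R / 20.
  case/andP: l2 => _ l2; case/andP: l3 => _ l3; case/andP: l5 => _ l5; case/andP: l7 => _ l7.
  case: d => [|d]; first by move=> _; rewrite /vonMangoldt (_ : primes 0 = [::]) // divr_ge0.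
  case: d => [|d]; first by move=> _; rewrite /vonMangoldt (_ : primes 1 = [::]) // divr_ge0.
  case: d => [|d]; first by move=> _; rewrite /vonMangoldt (_ : primes 2 = [:: 2]%N) // (_ : ub 2 = 14%N) //; lra.
  case: d => [|d]; first by move=> _; rewrite /vonMangoldt (_ : primes 3 = [:: 3]%N) // (_ : ub 3 = 22%N) //; lra.
  case: d => [|d]; first by move=> _; rewrite /vonMangoldt (_ : primes 4 = [:: 2]%N) // (_ : ub 4 = 14%N) //; lra.
  case: d => [|d]; first by move=> _; rewrite /vonMangoldt (_ : primes 5 = [:: 5]%N) // (_ : ub 5 = 33%N) //; lra.
  case: d => [|d]; first by move=> _; rewrite /vonMangoldt (_ : primes 6 = [:: 2; 3]%N) // divr_ge0.
  case: d => [|d]; first by move=> _; rewrite /vonMangoldt (_ : primes 7 = [:: 7]%N) // (_ : ub 7 = 39%N) //; lra.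
  case: d => [|d]; first by move=> _; rewrite /vonMangoldt (_ : primes 8 = [:: 2]%N) // (_ : ub 8 = 14%N) //; lra.
  case: d => [|d]; first by move=> _; rewrite /vonMangoldt (_ : primes 9 = [:: 3]%N) // (_ : ub 9 = 22%N) //; lra.
  case: d => [|d]; first by move=> _; rewrite /vonMangoldt (_ : primes 10 = [:: 2; 5]%N) // divr_ge0.
  case: d => [|d]; first by move=> _; rewrite /vonMangoldt (_ : primes 11 = [:: 11]%N) // (_ : ub 11 = 48%N) //; lra.
  case: d => [|d]; first by move=> _; rewrite /vonMangoldt (_ : primes 12 = [:: 2; 3]%N) // divr_ge0.
  case: d => [|d]; first by move=> _; rewrite /vonMangoldt (_ : primes 13 = [:: 13]%N) // (_ : ub 13 = 52%N) //; lra.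
  case: d => [|d]; first by move=> _; rewrite /vonMangoldt (_ : primes 14 = [:: 2; 7]%N) // divr_ge0.
  case: d => [|d]; first by move=> _; rewrite /vonMangoldt (_ : primes 15 = [:: 3; 5]%N) // divr_ge0.
  case: d => [|d]; first by move=> _; rewrite /vonMangoldt (_ : primes 16 = [:: 2]%N) // (_ : ub 16 = 14%N) //; lra.
  case: d => [|d]; first by move=> _; rewrite /vonMangoldt (_ : primes 17 = [:: 17]%N) // (_ : ub 17 = 57%N) //; lra.
  case: d => [|d]; first by move=> _; rewrite /vonMangoldt (_ : primes 18 = [:: 2; 3]%N) // divr_ge0.
  case: d => [|d]; first by move=> _; rewrite /vonMangoldt (_ : primes 19 = [:: 19]%N) // (_ : ub 19 = 59%N) //; lra.
  case: d => [|d]; first by move=> _; rewrite /vonMangoldt (_ : primes 20 = [:: 2; 5]%N) // divr_ge0.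
  case: d => [|d]; first by move=> _; rewrite /vonMangoldt (_ : primes 21 = [:: 3; 7]%N) // divr_ge0.
  case: d => [|d]; first by move=> _; rewrite /vonMangoldt (_ : primes 22 = [:: 2; 11]%N) // divr_ge0.
  by [].
have sumE : (\sum_(d < N) ub d * tent N d = sumn [seq ub d * tent N d | d <- iota 0 N])%N.
  by rewrite sumnE big_map -(big_mkord xpredT (fun d => ub d * tent N d)%N) /index_iota subn0.
(* The claim multiplied by 160, hence decidable over the integers. *)
pose ok n := (8 * sumn [seq ub d * tent n d | d <- iota 0 n] + 209 <= 44 * (n * n))%N.
have /allP allok : all ok (iota 3 21) by vm_compute.
have : ok N by apply: allok; rewrite mem_iota N_gt2.
rewrite /ok -sumE {allok} => check.
apply: (@le_trans _ _ ((\sum_(d < N) ub d * tent N d)%N%:R / 20)).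
  rewrite natr_sum mulr_suml; apply: ler_sum => d _.
  rewrite -[_ *+ tent _ _]mulr_natr natrM mulrAC ler_wpM2r // ubP //.
  by rewrite (leq_trans (ltn_ord d)) // -ltnS.
move: check; rewrite -(ler_nat R) natrD [X in X + _]natrM [X in _ <= X]natrM [X in _ <= _ * X]natrM.
by move: (\sum_(d < N) _)%N%:R => S h; lra.
Qed.
End TentChebyshev.

Section TentChebyshevBound.
Variable R : realType.
Implicit Types x y a b : R.

Lemma tent_psi_le2 K N : (N <= 2)%N -> tent_psi R K N = 0.
Proof.
move=> leN2; rewrite /tent_psi big1 // => -[[|[|d]] ltd] _ //=.
- by rewrite /vonMangoldt mul0rn.
- by rewrite /vonMangoldt mul0rn.
by rewrite tent_eq0 // (leq_trans leN2).
Qed.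

Lemma tent_log_mainM (N j : nat) : (0 < N)%N -> (0 < j)%N ->
  j%:R * tent_log_main (N%:R / j%:R) =
  N%:R ^+ 2 / 4 * ((ln N%:R - ln j%:R + ln 2 - 3 / 2) / j%:R) :> R.
Proof.
move=> N_gt0 j_gt0; have jR : 0 < (j%:R : R) by rewrite ltr0n.
rewrite /tent_log_main ln_div ?posrE ?ltr0n //; field.
by rewrite lt0r_neq0.
Qed.

(** The true order is N^2 / 4, so 11/40 allows ten percent. The last term of the kernel is the same
    sum at width N / 6, supplied by induction: (2/3 ln 2 + 1/2 ln 3) / 4, about 0.253, plus 11/1200
    stays below 11/40. The saving 19/4 is kept for [vonMangoldt_tent_multiple_le]. *)
Lemma tent_psi_le K N : (2 < N <= K)%N ->
  tent_psi R K N <= 11 / 40 * (N%:R ^+ 2 - 19 / 4).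
Proof.
elim/ltn_ind: N => N IHN /andP[N_gt2 leNK].
have [N_lt24|N_ge24] := ltnP N 24; first by rewrite tent_psi_small ?N_gt2.
have eN := divn_eq N 6; have lt6 := ltn_pmod N (isT : 0 < 6)%N.
set i := (N %/ 6)%N in eN; set rho := (N %% 6)%N in eN lt6.
have lti : (i < N)%N by lia.
have ltSi : (i.+1 < N)%N by lia.
have N_gt0 : (0 < N)%N by lia.
have leN3 : (3 < N <= K)%N by lia.
have leN26 : ((1 < 2 <= N) && (1 < 3 <= N) && (1 < 6 <= N))%N by lia.
have sqIH j : (j < N)%N -> tent_psi R K j <= 11 / 40 * j%:R ^+ 2.
  move=> ltjN; have [le_j2|lt2j] := leqP j 2.
    by rewrite tent_psi_le2 // mulr_ge0 ?sqr_ge0 //; lra.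
  apply: le_trans (IHN j ltjN _) _; first by rewrite lt2j (leq_trans (ltnW ltjN)).
  by rewrite ler_wpM2l //; lra.
(* Interpolating the square costs rho (6 - rho) / 6, at most 3/2. *)
have h7 : \sum_(d < K) vonMangoldt R d *+ tent N (d * 6) <= 11 / 40 * (N%:R ^+ 2 / 6 + 3 / 2).
  rewrite eN (sum_tent_interpolate (vonMangoldt R)); last by exact: ltnW.
  have p1 := sqIH i lti; have p2 := sqIH i.+1 ltSi.
  have s1 : 0 <= ((6 - rho)%:R : R) by []; have s2 : 0 <= (rho%:R : R) by [].
  apply: le_trans (lerD (ler_wpM2l s1 p1) (ler_wpM2l s2 p2)) _.
  rewrite natrB ?(ltnW lt6) // -[i.+1%:R]natr1 natrD natrM.
  have := sqr_ge0 (rho%:R - 3 : R).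
  by move: (i%:R : R) (rho%:R : R) => a b; lra.
have [[/andP[l2lo l2up] /andP[l3lo l3up] _ _] _] := ln_small_bounds R.
have h0 := tent_psi_kernel R leNK.
have h1 := @tent_log_le R K N leN3.
case/andP: leN26 => /andP[le2 le3] le6.
have h2 := @tent_log_multiples_ge R K N 2 le2 leNK.
have h3 := @tent_log_multiples_ge R K N 3 le3 leNK.
have h6 := @tent_log_multiples_ge R K N 6 le6 leNK.
have ln6 : ln (6 : R) = ln 2 + ln 3 by exact: (@ln_natM R 2 3).
have ln24 : ln (24 : R) = ln 2 + (ln 2 + (ln 2 + ln 3)).
  by rewrite -(@ln_natM R 2 3) // -(@ln_natM R 2 6) // -(@ln_natM R 2 12).
have NR : 24 <= (N%:R : R) by rewrite ler_nat.
have lnj (j : nat) : (0 < j)%N -> ln (N%:R / j%:R) = ln (N%:R : R) - ln j%:R.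
  by move=> j_gt0; rewrite ln_div ?posrE ?ltr0n.
rewrite tent_log_mainM // lnj // in h2; rewrite tent_log_mainM // lnj // in h3.
rewrite tent_log_mainM // lnj // in h6.
have lN : ln (N%:R : R) <= ln 24 + (N%:R / 24 - 1).
  by have := @ln_le_subr1 R (N%:R / 24) ltac:(lra); rewrite lnj //; lra.
rewrite /tent_log_main in h1; rewrite ln6 in h6; rewrite ln24 in lN.
set l := ln (N%:R : R) in h1 h2 h3 h6 lN.
set n : R := N%:R in NR h1 h2 h3 h6 h7 lN *.
set T := tent_psi R K N in h0 *.
have main : T <= n ^+ 2 / 4 * (2 / 3 * ln 2 + ln 3 / 2) + (1 + l) / 8
   + (11 * l - 8 * ln 2 - 9 * ln 3) / 4 + 11 / 200 * (n ^+ 2 / 6 + 3 / 2) by lra.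
apply: le_trans main _.
have q : n ^+ 2 / 4 * (2 / 3 * ln 2 + ln 3 / 2)
    <= n ^+ 2 / 4 * (2 / 3 * (43 / 62) + 11 / 10 / 2).
  by rewrite ler_wpM2l ?divr_ge0 ?sqr_ge0 //; lra.
have n2 : 24 * n <= n ^+ 2 by rewrite expr2 ler_wpM2r //; lra.
clear h0 h1 h2 h3 h6 h7 ln6 ln24 lnj sqIH IHN; clearbody l n; lra.
Qed.

Lemma tent_psi_le_sqr K N : (N <= K)%N -> tent_psi R K N <= 11 / 40 * N%:R ^+ 2.
Proof.
move=> leNK; have [le_N2|lt2N] := leqP N 2.
  by rewrite tent_psi_le2 // mulr_ge0 ?sqr_ge0 //; lra.
by apply: le_trans (tent_psi_le _) _; rewrite ?lt2N // ler_wpM2l //; lra.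
Qed.
End TentChebyshevBound.

(** * The smooth cutoff of 1/n and Mertens' bound *)

Section Cutoff.
Variable R : realType.

Definition cutoff_weight (k : nat) : R := 4 / (k.+1%:R * k.+2%:R * k.+3%:R).

(* The tents of width k + 2 with weights 4 / ((k + 1) (k + 2) (k + 3)) sum up to 1 / n. *)
Definition cutoff (N n : nat) : R := \sum_(k < N.-1) cutoff_weight k *+ tent k.+2 n.

Lemma cutoff_weight_gt0 k : 0 < cutoff_weight k.
Proof. by rewrite divr_gt0 ?mulr_gt0 ?ltr0n. Qed.

Lemma cutoff_ge0 N n : 0 <= cutoff N n.
Proof. by apply: sumr_ge0 => k _; rewrite mulrn_wge0 // ltW // cutoff_weight_gt0. Qed.

Lemma cutoffS N n : cutoff N.+2 n = cutoff N.+1 n + cutoff_weight N *+ tent N.+2 n.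
Proof. by rewrite /cutoff big_ord_recr. Qed.

Lemma cutoff_eq0 N n : (N <= n)%N -> cutoff N n = 0.
Proof.
move=> leNn; rewrite /cutoff big1 // => k _; rewrite tent_eq0 //.
by have := ltn_ord k; lia.
Qed.

Lemma cutoff0 N : cutoff N 0 = 0.
Proof. by rewrite /cutoff big1 // => k _; rewrite tent0. Qed.

Lemma cutoff_hi N n : (0 < n)%N -> (n <= N <= 2 * n)%N ->
  cutoff N n = 2 * (N%:R - n%:R) * (N%:R + 1 - n%:R) / (n%:R * N%:R * (N%:R + 1)).
Proof.
move=> n_gt0 /andP[lenN]; rewrite -(subnKC lenN).
elim: (N - n)%N => [|j IHj] leN.
  by rewrite addn0 cutoff_eq0 // subrr mulr0 !mul0r.
have {}IHj := IHj ltac:(lia).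
case e: (n + j)%N IHj => [|m] IHj; first by lia.
rewrite addnS e cutoffS IHj; have -> : tent m.+2 n = (m.+2 - n)%N by rewrite /tent; lia.
rewrite -[cutoff_weight m *+ _]mulr_natr natrB; last by lia.
have nR : 0 < (n%:R : R) by rewrite ltr0n.
have mR : 0 <= (m%:R : R) by [].
rewrite /cutoff_weight -[m.+3%:R]natr1 -[m.+2%:R]natr1 -[m.+1%:R]natr1.
move: (n%:R : R) (m%:R : R) nR mR => a b a_gt0 b_ge0.
field; rewrite ?lt0r_neq0 //=; lra.
Qed.

(** Past N = 2 n every added tent takes the value n at n, and the weights telescope. *)
Lemma cutoff_lo N n : (0 < n)%N -> (2 * n <= N)%N ->
  cutoff N n = n%:R^-1 - 2 * n%:R / (N%:R * (N%:R + 1)).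
Proof.
move=> n_gt0 le2nN; rewrite -(subnKC le2nN).
have nR : 0 < (n%:R : R) by rewrite ltr0n.
elim: (N - 2 * n)%N => [|j IHj].
  rewrite addn0 cutoff_hi ?leqnn //; last by lia.
  rewrite natrM; field; rewrite ?lt0r_neq0 //=; lra.
case e: (2 * n + j)%N IHj => [|m] IHj; first by lia.
rewrite addnS e cutoffS IHj; have -> : tent m.+2 n = n by rewrite /tent; lia.
rewrite -[cutoff_weight m *+ _]mulr_natr; have mR : 0 <= (m%:R : R) by [].
rewrite /cutoff_weight -[m.+3%:R]natr1 -[m.+2%:R]natr1 -[m.+1%:R]natr1.
move: (n%:R : R) (m%:R : R) nR mR => a b a_gt0 b_ge0.
field; rewrite ?lt0r_neq0 //=; lra.
Qed.

Lemma cutoff_mul_nonincreasing N m n : (0 < m <= n)%N ->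
  n%:R * cutoff N n <= m%:R * cutoff N m.
Proof.
move=> /andP[m_gt0 lemn]; have n_gt0 : (0 < n)%N by lia.
have [leNn|ltnN] := leqP N n.
  by rewrite (cutoff_eq0 leNn) mulr0 mulr_ge0 // cutoff_ge0.
have N_gt0 : (0 < N)%N by lia.
have aR : 0 < (m%:R : R) by rewrite ltr0n.
have bR : m%:R <= (n%:R : R) by rewrite ler_nat.
have cR : n%:R <= (N%:R : R) by rewrite ler_nat ltnW.
have NR : 0 < (N%:R * (N%:R + 1) : R) by rewrite mulr_gt0 //; lra.
have hi k : (0 < k)%N -> (k <= N <= 2 * k)%N ->
    k%:R * cutoff N k = 2 * (N%:R - k%:R) * (N%:R + 1 - k%:R) / (N%:R * (N%:R + 1)).
  move=> k_gt0 kN; rewrite cutoff_hi //; field.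
  by rewrite ?lt0r_neq0 ?ltr0n //=; lra.
have lo k : (0 < k)%N -> (2 * k <= N)%N ->
    k%:R * cutoff N k = (N%:R * (N%:R + 1) - 2 * k%:R ^+ 2) / (N%:R * (N%:R + 1)).
  move=> k_gt0 kN; rewrite cutoff_lo //; field.
  by rewrite ?lt0r_neq0 ?ltr0n //=; lra.
have [le2n|lt2n] := leqP (2 * n) N.
  rewrite !lo //; last by lia.
  by rewrite ler_pM2r ?invr_gt0 // lerB // ler_wpM2l // !expr2 ler_pM // ltW.
have nN : (n <= N <= 2 * n)%N by rewrite (ltnW ltnN) (ltnW lt2n).
rewrite (hi n) //; have [le2m|lt2m] := leqP (2 * m) N.
  rewrite lo // ler_pM2r ?invr_gt0 //.
  have h1 : 2 * m%:R <= (N%:R : R) by rewrite -natrM ler_nat.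
  have h2 : N%:R <= 2 * (n%:R : R) by rewrite -natrM ler_nat ltnW.
  nra.
rewrite (hi m) // ?ler_pM2r ?invr_gt0 //; last by rewrite (ltnW lt2m) (leq_trans lemn) // ltnW.
by apply: ler_pM; [lra|lra|lra|lra].
Qed.

Lemma cutoff_multiple_le N d m : (0 < d)%N -> (0 < m)%N ->
  cutoff N (d * m) <= cutoff N m / d%:R.
Proof.
move=> d_gt0 m_gt0; have := @cutoff_mul_nonincreasing N m (d * m)%N.
rewrite m_gt0 leq_pmull // => /(_ isT); rewrite natrM => h.
have dR : 0 < (d%:R : R) by rewrite ltr0n.
have mR : 0 < (m%:R : R) by rewrite ltr0n.
by rewrite ler_pdivlMr // -(ler_pM2l mR); move: h; congr (_ <= _); ring.
Qed.

(** At width N = 2 n the lower bound for [tent_sum] reads 1/d <= 4 T / N^2 + d / N^2, and d is the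
    tent itself for d <= n. So the sum is bounded by [tent_log] and [tent_psi], both already
    estimated. *)
Lemma mertens_le n : (0 < n)%N ->
  \sum_(d < n.+1) vonMangoldt R d / d%:R <= ln n%:R + 1 / 3.
Proof.
move=> n_gt0; have [le_n1|n_gt1] := leqP n 1.
  have -> : n = 1%N by lia.
  by rewrite !big_ord_recr big_ord0 /= /vonMangoldt /= !mul0r !add0r ln1; lra.
pose N := (2 * n)%N; have leNN : (N <= N)%N by [].
have n3N : (3 < N <= N)%N by rewrite /N; lia.
have ltnN : (n.+1 <= N)%N by rewrite /N; lia.
have tentn d : (d < n.+1)%N -> tent N d = d by rewrite /tent /N; lia.
have N4 : (4 <= N)%N by rewrite /N; lia.
have lnN : ln (N%:R : R) = ln 2 + ln n%:R by rewrite /N ln_natM.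
clearbody N.
have NR : 4 <= (N%:R : R) by rewrite ler_nat.
have step1 : \sum_(d < n.+1) vonMangoldt R d / d%:R <= \sum_(d < N)
    (vonMangoldt R d *+ tent_sum N N (d * 1) * (4 / N%:R ^+ 2)
     + vonMangoldt R d *+ tent N d / N%:R ^+ 2).
  pose F d := vonMangoldt R d *+ tent_sum N N (d * 1) * (4 / N%:R ^+ 2)
     + vonMangoldt R d *+ tent N d / N%:R ^+ 2.
  have F_ge0 d : 0 <= F d.
    have L := vonMangoldt_ge0 R d.
    by rewrite addr_ge0 // ?mulr_ge0 ?divr_ge0 ?mulrn_wge0 ?exprn_ge0 //; lra.
  apply: (@le_trans _ _ (\sum_(d < n.+1) F d)); last first.
    rewrite -!(big_mkord xpredT F) (big_cat_nat (leq0n n.+1) ltnN) /= lerDl.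
    by apply: sumr_ge0.
  apply: ler_sum => d _; have [->|d_gt0] := posnP d.
    by rewrite vonMangoldt0 mul0r F_ge0.
  have := @tent_sum_lb N N d d_gt0 leNN; rewrite -(ler_nat R) natrD !natrM => h.
  have dR : 0 < (d%:R : R) by rewrite ltr0n.
  rewrite /F muln1 tentn // -![vonMangoldt R d *+ _]mulr_natr -!mulrA -mulrDr.
  rewrite ler_wpM2l ?vonMangoldt_ge0 // -div1r ler_pdivrMr //.
  rewrite [leRHS](_ : _ = (4 * d%:R * (tent_sum N N d)%:R + d%:R * d%:R) / (N%:R * N%:R)).
    by rewrite ler_pdivlMr; [lra | apply: mulr_gt0; lra].
  by field; rewrite lt0r_neq0 //; lra.
apply: le_trans step1 _; rewrite big_split /= -!mulr_suml sum_vonMangoldt_tent_sum //.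
under eq_bigr => d _ do rewrite muln1.
have h1 := @tent_log_le R N N n3N; have h2 := @tent_psi_le_sqr R N N leNN.
rewrite -/(tent_log R N N) -/(tent_psi R N N).
have N2_gt0 : 0 < (N%:R ^+ 2 : R) by rewrite exprn_gt0 //; lra.
have e1 : tent_log R N N * (4 / N%:R ^+ 2)
    <= (tent_log_main N%:R + (1 + ln N%:R) / 8) * (4 / N%:R ^+ 2).
  by rewrite ler_wpM2r // divr_ge0 // ltW.
have e2 : tent_psi R N N / N%:R ^+ 2 <= 11 / 40 by rewrite ler_pdivrMr.
apply: le_trans (lerD e1 e2) _.
have [[/andP[_ l2up] _ _ _] _] := ln_small_bounds R.
have lnN1 := @ln_le_subr1 R N%:R ltac:(lra).
have -> : (tent_log_main N%:R + (1 + ln N%:R) / 8) * (4 / N%:R ^+ 2)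
   = ln N%:R + ln 2 - 3 / 2 + (1 + ln N%:R) / (2 * N%:R ^+ 2) :> R.
  by rewrite /tent_log_main; field; rewrite lt0r_neq0 //; lra.
have e3 : (1 + ln N%:R) / (2 * N%:R ^+ 2) <= 1 / 8 :> R.
  by rewrite ler_pdivrMr; [nra|lra].
by rewrite lnN in e3 *; lra.
Qed.

(** The bound is by the cutoff and not by 1/m because r is controlled only against cutoffs. For m <=
    B, in units of 11/40, passing from 1/m to the cutoff costs at most 9 m / 2 and interpolation at
    most m / 4: exactly the 19 m / 4 saved in [tent_psi_le]. For m > B only d = 2 contributes. *)
Lemma vonMangoldt_tent_multiple_le K B m : (0 < B)%N -> (0 < m)%N -> (3 * B < K)%N ->
  \sum_(d < K) vonMangoldt R d *+ tent (3 * B) (d * m)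
  <= 11 / 10 * (9 * B%:R ^+ 2 / 4) * cutoff (2 * B) m.
Proof.
move=> B_gt0 m_gt0 ltK.
have BR : 0 < (B%:R : R) by rewrite ltr0n.
have mR : 0 < (m%:R : R) by rewrite ltr0n.
have [lemB|ltBm] := leqP m B.
  have eN := divn_eq (3 * B) m; have lt_rho := ltn_pmod (3 * B) m_gt0.
  set N := (3 * B %/ m)%N in eN; set rho := (_ %% _)%N in eN lt_rho.
  have N_gt2 : (2 < N)%N by rewrite leq_divRL //; lia.
  have leN : (2 < N <= K)%N by rewrite N_gt2; nia.
  have leSN : (2 < N.+1 <= K)%N by rewrite ltnW; nia.
  have le2B : (2 * m <= 2 * B)%N by lia.
  rewrite eN (sum_tent_interpolate (vonMangoldt R)); last exact: ltnW.
  have s1 : 0 <= ((m - rho)%:R : R) by []; have s2 : 0 <= (rho%:R : R) by [].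
  have rm : rho%:R <= (m%:R : R) by rewrite ler_nat ltnW.
  apply: le_trans (lerD (ler_wpM2l s1 (tent_psi_le R leN)) (ler_wpM2l s2 (tent_psi_le R leSN))) _.
  have eR : 3 * B%:R = N%:R * m%:R + rho%:R :> R by rewrite -[N%:R * _]natrM -natrD -eN natrM.
  rewrite cutoff_lo // natrB ?(ltnW lt_rho) // -[N.+1%:R]natr1 natrM.
  rewrite [leRHS](_ : _ = 11 / 40 * ((3 * B%:R) ^+ 2 / m%:R
      - 9 * B%:R * m%:R / (2 * B%:R + 1))); last first.
    by field; rewrite ?lt0r_neq0 //=; lra.
  rewrite [leLHS](_ : _ = 11 / 40 * ((N%:R * m%:R + rho%:R) ^+ 2 / m%:R
      + (rho%:R - rho%:R ^+ 2 / m%:R - 19 / 4 * m%:R))); last first.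
    by field; rewrite ?lt0r_neq0.
  rewrite eR ler_wpM2l // lerD2l.
  have q1 : 9 * B%:R * m%:R / (2 * B%:R + 1) <= 9 / 2 * m%:R :> R.
    by rewrite ler_pdivrMr; nra.
  have q2 : rho%:R - rho%:R ^+ 2 / m%:R <= m%:R / 4 :> R.
    rewrite lerBlDr -lerBlDl ler_pdivlMr //; have := sqr_ge0 (m%:R - 2 * rho%:R : R); nra.
  lra.
have small d : (2 < d)%N -> tent (3 * B) (d * m) = 0%N by move=> ?; rewrite tent_eq0 //; nia.
have RHS_ge0 : 0 <= 11 / 10 * (9 * B%:R ^+ 2 / 4) * cutoff (2 * B) m.
  by rewrite mulr_ge0 ?cutoff_ge0 // mulr_ge0 ?divr_ge0 ?mulr_ge0 ?sqr_ge0.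
have two : \sum_(d < K) vonMangoldt R d *+ tent (3 * B) (d * m)
    = ln 2 *+ tent (3 * B) (2 * m).
  have lt2K : (2 < K)%N by lia.
  rewrite (bigD1 (Ordinal lt2K)) //= {1}/vonMangoldt (_ : primes 2 = [:: 2]%N) //.
  have L1 : vonMangoldt R 1 = 0 by [].
  rewrite big1 ?addr0 // => -[[|[|[|d]]] ltd] // _ /=.
  - by rewrite vonMangoldt0 mul0rn.
  - by rewrite L1 mul0rn.
  by rewrite small.
rewrite two; have [le3B|lt2m] := leqP (3 * B) (2 * m); first by rewrite tent_eq0.
have tle : (tent (3 * B) (2 * m) <= 3 * B - 2 * m)%N by rewrite /tent geq_minr.
have mB : (m <= 2 * B <= 2 * m)%N by lia.
have lt2mR : 2 * m%:R <= 3 * (B%:R : R) by rewrite -!natrM ler_nat ltnW.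
have ltBmR : B%:R <= (m%:R : R) by rewrite ler_nat ltnW.
have [[/andP[l2lo l2up] _ _ _] _] := ln_small_bounds R.
have step : ln 2 *+ tent (3 * B) (2 * m) <= 7 / 10 * (3 * B%:R - 2 * m%:R) :> R.
  rewrite -[ln 2 *+ _]mulr_natr ler_pM //; [lra|lra|].
  by rewrite -!natrM -natrB ?ler_nat // ltnW.
apply: le_trans step _; rewrite cutoff_hi // natrM.
rewrite -(ler_pM2r mR) [leRHS](_ : _ = 99 / 40 * B%:R * ((2 * B%:R - m%:R)
   * (2 * B%:R + 1 - m%:R) / (2 * B%:R + 1))); last first.
  by field; rewrite ?lt0r_neq0 //=; lra.
have key : (2 * B%:R - m%:R) ^+ 2 / (2 * B%:R)
    <= (2 * B%:R - m%:R) * (2 * B%:R + 1 - m%:R) / (2 * B%:R + 1) :> R.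
  rewrite ler_pdivrMr; last by lra.
  rewrite mulrAC ler_pdivlMr; last by lra.
  nra.
apply: (@le_trans _ _ (99 / 40 * B%:R * ((2 * B%:R - m%:R) ^+ 2 / (2 * B%:R)))); last first.
  by rewrite ler_wpM2l // mulr_ge0 //; lra.
rewrite [leRHS](_ : _ = 99 / 80 * (2 * B%:R - m%:R) ^+ 2); last first.
  by field; rewrite lt0r_neq0.
(* What remains is 211 m^2 - 564 m B + 396 B^2 >= 0, a form of negative discriminant; 52 times this
   square has the same cross term. *)
have := sqr_ge0 (2 * m%:R - 141 / 52 * B%:R : R); nra.
Qed.
End Cutoff.

(** * Masses of the tents that make up the cutoff *)

Section CutoffMass.
Variable R : realType.

(** The weight of the tent of width k + 2 times its approximate area (k + 2)^2 / 4. It is also the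
    mean of 1/(k + 1) and 1/(k + 3), so its sums are logarithms up to small errors. *)
Definition cutoff_mass (k : nat) : R := k.+2%:R / (k.+1%:R * k.+3%:R).

Lemma cutoff_mass_gt0 k : 0 < cutoff_mass k.
Proof. by rewrite divr_gt0 ?mulr_gt0 ?ltr0n. Qed.

Lemma cutoff_massE k : cutoff_mass k = cutoff_weight R k * (k.+2%:R ^+ 2 / 4).
Proof.
have kR : 0 <= (k%:R : R) by [].
rewrite /cutoff_mass /cutoff_weight -[k.+3%:R]natr1 -[k.+2%:R]natr1 -[k.+1%:R]natr1.
by move: (k%:R : R) kR => x x_ge0; field; rewrite ?lt0r_neq0 //=; lra.
Qed.

Lemma cutoff_mass_le_lnS k : cutoff_mass k <= ln k.+2%:R - ln k.+1%:R.
Proof.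
apply: le_trans (lnS_ge R (ltn0Sn k)).
have kR : 0 <= (k%:R : R) by [].
rewrite /cutoff_mass -[k.+3%:R]natr1 -[k.+2%:R]natr1 -[k.+1%:R]natr1.
move: (k%:R : R) kR => x x_ge0.
rewrite ler_pdivrMr; last by apply: mulr_gt0; lra.
by rewrite mulrAC ler_pdivlMr; [nra|lra].
Qed.

Lemma cutoff_mass_sum_ub a b : (a <= b)%N ->
  \sum_(a <= k < b) cutoff_mass k <= ln b.+1%:R - ln a.+1%:R.
Proof.
move=> leab; rewrite -(telescope_sumr (fun k => ln (k.+1%:R : R))) //.
by apply: ler_sum => k _; exact: cutoff_mass_le_lnS.
Qed.

Lemma cutoff_mass_sum_lb a b : (a <= b)%N ->
  ln (b.+1%:R : R) - ln a.+1%:R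
  <= \sum_(a <= k < b) cutoff_mass k + (a.+2%:R^-1 - b.+2%:R^-1) / 2.
Proof.
move=> leab; rewrite -(subnKC leab).
elim: (b - a)%N => [|j IHj]; first by rewrite addn0 big_geq // !subrr mul0r addr0.
rewrite addnS big_nat_recr /=; last by rewrite leq_addr.
set n := (a + j)%N in IHj *; have h := @lnS_le R n.+1 isT.
have e : cutoff_mass n = (n.+1%:R^-1 + n.+3%:R^-1) / 2.
  rewrite /cutoff_mass -[n.+3%:R]natr1 -[n.+2%:R]natr1 -[n.+1%:R]natr1.
  have nR : 0 <= (n%:R : R) by [].
  move: (n%:R : R) nR => x x_ge0; field; rewrite ?lt0r_neq0 //=; lra.
rewrite e; move: IHj h.
move: (ln n.+2%:R) (ln n.+1%:R) (ln a.+1%:R) (\sum_(_ <= _ < _) _) (n.+1%:R^-1)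
  (n.+2%:R^-1) (n.+3%:R^-1) (a.+2%:R^-1) => x1 x2 x3 x4 x5 x6 x7 x8 IH h.
lra.
Qed.

(** The discrete form of the integral of u being u^2 / 2: the logarithm is the mass lying above k,
    up to t, and the induction removes the lowest mass. *)
Lemma cutoff_mass_ln_sum a b t : (forall k, (a <= k)%N -> (k.+3%:R : R)^-1 / 2 <= t) ->
  (a <= b)%N ->
  \sum_(a <= k < b) cutoff_mass k * (ln b.+1%:R - ln k.+2%:R)
  <= (\sum_(a <= k < b) cutoff_mass k) ^+ 2 / 2 + (\sum_(a <= k < b) cutoff_mass k) * t.
Proof.
move=> ht leab; have [j ej] : exists j, (b = a + j)%N by exists (b - a)%N; rewrite subnKC.
elim: j a ht leab ej => [|j IHj] a ht leab ej.
  by rewrite !big_geq // ?ej ?addn0 // expr0n /= !mul0r addr0.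
have ltab : (a < b)%N by rewrite ej -addSnnS leq_addr.
have -> : \sum_(a <= k < b) cutoff_mass k = cutoff_mass a + \sum_(a.+1 <= k < b) cutoff_mass k.
  exact: big_ltn.
rewrite [leLHS](big_ltn ltab).
have {}IHj := IHj a.+1 (fun k hk => ht k (ltnW hk)) ltab ltac:(lia).
have h := @cutoff_mass_sum_lb a.+1 b ltab.
have b_ge0 : 0 <= (b.+2%:R : R)^-1 by rewrite invr_ge0.
have h2 := ht a (leqnn a); have w := cutoff_mass_gt0 a.
set Q := \sum_(a.+1 <= _ < b) cutoff_mass _ in IHj h *.
have hQ : ln b.+1%:R - ln a.+2%:R <= Q + t.
  apply: le_trans h _; rewrite lerD2l; apply: le_trans h2.
  by rewrite ler_wpM2r // lerBlDr lerDl.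
have := ler_wpM2l (ltW w) hQ; have := sqr_ge0 (cutoff_mass a).
move: (cutoff_mass a) (ln b.+1%:R - ln a.+2%:R) IHj => p l IH h3 h4.
by nra.
Qed.

Lemma sum_tent K N : (N <= K)%N -> (4 * \sum_(n < K) tent N n <= N * N)%N.
Proof.
move=> leNK; have := @tent_sum_ub K N 1 isT leNK; rewrite muln1 /tent_sum.
by under eq_bigr => n _ do rewrite mul1n.
Qed.

Lemma inv_le_ln_odd k : (0 < k)%N ->
  (k%:R : R)^-1 <= ln (2 * k%:R + 1) - ln (2 * k%:R - 1).
Proof.
move=> k_gt0; have kR : 1 <= (k%:R : R) by rewrite ler1n.
have b_gt0 : 0 < (2 * k%:R : R)^-1 by rewrite invr_gt0; lra.
have b_le : (2 * k%:R : R)^-1 <= 2^-1 by rewrite lef_pV2 ?posrE; lra.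
have := @ln_midpoint R (2 * k%:R)^-1 ltac:(apply/andP; split; lra).
have -> : 1 + (2 * k%:R : R)^-1 = (2 * k%:R + 1) / (2 * k%:R).
  by field; rewrite lt0r_neq0 //; lra.
have -> : 1 - (2 * k%:R : R)^-1 = (2 * k%:R - 1) / (2 * k%:R).
  by field; rewrite lt0r_neq0 //; lra.
rewrite !ln_div ?posrE; [|lra|lra|lra|lra].
rewrite (_ : 2 * (2 * k%:R)^-1 = k%:R^-1 :> R); last by field; rewrite lt0r_neq0 //; lra.
lra.
Qed.

(** The total is at most ln N + 1 + ln 2 + 1/200 - (ln 5 + 2 ln 3) / 2, just below ln N - 1/5. This
    requires the exact area 2 of the tent of width 3 in place of 9/4. *)
Lemma cutoff_sum_le K N : (100 <= N)%N -> (N <= K)%N ->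
  \sum_(n < K) cutoff R N n <= ln N%:R - 1 / 5.
Proof.
move=> N_ge leNK; rewrite /cutoff exchange_big /=.
have le2 : (2 <= N.-1)%N by lia.
have leKk k : (k < N.-1)%N -> (k.+2 <= K)%N by lia.
have N1S : (N.-1.+1 = N)%N by lia.
have NR : 100 <= (N%:R : R) by rewrite ler_nat.
have inner k : \sum_(n < K) cutoff_weight R k *+ tent k.+2 n
    = cutoff_weight R k * (\sum_(n < K) tent k.+2 n)%N%:R.
  by rewrite natr_sum mulr_sumr; apply: eq_bigr => n _; rewrite mulr_natr.
have innerle k : (k < N.-1)%N -> \sum_(n < K) cutoff_weight R k *+ tent k.+2 n <= cutoff_mass k.
  move=> ltk; rewrite inner cutoff_massE ler_wpM2l //; first exact: ltW (cutoff_weight_gt0 R k).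
  have := sum_tent (leKk k ltk); rewrite -(ler_nat R) !natrM.
  move: ((\sum_(n < K) tent k.+2 n)%N%:R : R) (k.+2%:R : R) => x y.
  by lra.
have inner1 : \sum_(n < K) cutoff_weight R 1 *+ tent 3 n <= 1 / 3.
  have le3 : (3 <= K)%N by apply: leKk.
  have : (\sum_(n < K) tent 3 n <= 2)%N by have := sum_tent le3; lia.
  rewrite inner -(ler_nat R) /cutoff_weight => h.
  by have := @ler_wpM2l R (4 / (2 * 3 * 4)) ltac:(lra) _ _ h; lra.
have mass0 : cutoff_mass 0 = 2 / 3 by rewrite /cutoff_mass; field.
pose F k := \sum_(n < K) cutoff_weight R k *+ tent k.+2 n.
rewrite -(big_mkord xpredT F) (big_cat_nat (leq0n 2) le2) /=.
(* Applying 1/j <= ln(2 j + 1) - ln(2 j - 1) at j = k + 1 and j = k + 3 and averaging bounds the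
   mass by v(k + 1) - v(k). *)
pose v k : R := (ln (2 * k.+1%:R - 1) + ln (2 * k.+1%:R + 3)) / 2.
have tail : \sum_(2 <= k < N.-1) F k <= v N.-1 - v 2%N.
  rewrite -(telescope_sumr v) // [leLHS]big_nat_cond [leRHS]big_nat_cond.
  apply: ler_sum => k /andP[/andP[_ ltk] _]; apply: le_trans (innerle k ltk) _.
  have h1 := @inv_le_ln_odd k.+1 isT; have h3 := @inv_le_ln_odd k.+3 isT.
  have kR : 0 <= (k%:R : R) by [].
  have -> : cutoff_mass k = (k.+1%:R^-1 + k.+3%:R^-1) / 2.
    rewrite /cutoff_mass -[k.+3%:R]natr1 -[k.+2%:R]natr1 -[k.+1%:R]natr1.
    move: (k%:R : R) kR => x x_ge0; field; rewrite ?lt0r_neq0 //=; lra.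
  rewrite /v; rewrite (_ : 2 * k.+3%:R + 1 = 2 * k.+2%:R + 3 :> R) in h3; last first.
    by rewrite -[k.+3%:R]natr1; lra.
  rewrite (_ : 2 * k.+3%:R - 1 = 2 * k.+1%:R + 3 :> R) in h3; last first.
    by rewrite -[k.+3%:R]natr1 -[k.+2%:R]natr1; lra.
  rewrite (_ : 2 * k.+1%:R + 1 = 2 * k.+2%:R - 1 :> R) in h1; last first.
    by rewrite -[k.+2%:R]natr1; lra.
  move: h1 h3; move: (ln _) (ln _) (ln _) (ln _) (k.+1%:R^-1) (k.+3%:R^-1).
  by move=> x1 x2 x3 x4 x5 x6; lra.
have head : \sum_(0 <= k < 2) F k <= 1.
  rewrite big_nat_recr //= big_nat1; have := innerle 0%N (ltnW le2).
  by rewrite mass0 -/(F 0%N) => h; rewrite -/(F 1%N) in inner1; lra.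
have [[/andP[_ l2up] /andP[l3lo _] /andP[l5lo _] _] _] := ln_small_bounds R.
have v2 : v 2%N = (ln 5 + (ln 3 + ln 3)) / 2.
  have -> : v 2%N = (ln 5 + ln (3 * 3)) / 2 by rewrite /v; congr ((ln _ + ln _) / 2); lra.
  by rewrite lnM ?posrE ?ltr0n.
have vN : v N.-1 <= ln 2 + ln N%:R + 1 / 200.
  rewrite /v N1S.
  have e1 : 2 * N%:R - 1 = 2 * N%:R * (1 - (2 * N%:R)^-1) :> R.
    by field; rewrite lt0r_neq0 //; lra.
  have e2 : 2 * N%:R + 3 = 2 * N%:R * (1 + 3 * (2 * N%:R)^-1) :> R.
    by field; rewrite lt0r_neq0 //; lra.
  have i_gt0 : 0 < (2 * N%:R : R)^-1 by rewrite invr_gt0; lra.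
  have i_le : (2 * N%:R : R)^-1 <= 200^-1 by rewrite lef_pV2 ?posrE; lra.
  rewrite e1 e2 !lnM ?posrE; try lra.
  have := @ln_le_subr1 R (1 - (2 * N%:R)^-1) ltac:(lra).
  have := @ln_le_subr1 R (1 + 3 * (2 * N%:R)^-1) ltac:(lra).
  by lra.
by rewrite v2 in tail; lra.
Qed.

Lemma sum_mul_ln_ratio_le A : (0 < A)%N ->
  \sum_(n < A) (n%:R : R) * (ln A%:R - ln n%:R) <= A%:R ^+ 2 / 4.
Proof.
elim: A => // A IHA _; have [->|A_gt0] := posnP A.
  by rewrite big_ord_recr big_ord0 /= mul0r add0r; lra.
have AR : 0 < (A%:R : R) by rewrite ltr0n.
have -> : \sum_(n < A.+1) (n%:R : R) * (ln A.+1%:R - ln n%:R)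
   = \sum_(n < A) (n%:R : R) * (ln A%:R - ln n%:R)
     + (\sum_(n < A.+1) (n%:R : R)) * (ln A.+1%:R - ln A%:R).
  rewrite mulr_suml !big_ord_recr /= addrA -big_split /=; congr (_ + _).
  by apply: eq_bigr => n _; ring.
have -> : \sum_(n < A.+1) (n%:R : R) = A%:R * (A%:R + 1) / 2.
  elim: (A) => [|a IHa]; first by rewrite big_ord_recr big_ord0 /= !mul0r addr0.
  by rewrite big_ord_recr IHa /= -[a.+1%:R]natr1; field.
have h := lnS_le R A_gt0; rewrite -[A.+1%:R^-1]/((A.+1%:R)^-1) in h.
have : A%:R * (A%:R + 1) / 2 * (ln A.+1%:R - ln A%:R) <= (2 * A%:R + 1) / 4 :> R.
  apply: le_trans (ler_wpM2l _ h) _; first by rewrite !mulr_ge0 //; lra.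
  rewrite -[A.+1%:R]natr1 le_eqVlt; apply/orP; left; apply/eqP.
  by field; rewrite ?lt0r_neq0 //=; lra.
have := IHA A_gt0; rewrite -[A.+1%:R]natr1; lra.
Qed.
End CutoffMass.

(** * The defect 1 - c of a multiplicative function *)

Section MultiplicativeSums.
Variables (R : realType) (c : nat -> R).
Hypothesis cM : forall m n, c (m * n)%N = c m * c n.
Hypothesis c_bound : forall n, -1 <= c n <= 1.

Let r n := 1 - c n.

Let r_ge0 n : 0 <= r n.
Proof. by have := c_bound n; rewrite /r; lra. Qed.

Let r_le2 n : r n <= 2.
Proof. by have := c_bound n; rewrite /r; lra. Qed.

Lemma defect_mul_le d m : 1 - c (d * m)%N <= (1 - c d) + (1 - c m).
Proof. by rewrite cM; have := mulr_ge0 (r_ge0 d) (r_ge0 m); rewrite /r; lra. Qed.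

Lemma defect_mul_ge d m : (1 - c d) - (1 - c m) <= 1 - c (d * m)%N.
Proof.
rewrite cM; have h : 0 <= 1 + c d by have := c_bound d; lra.
by have := mulr_ge0 (r_ge0 m) h; rewrite /r; lra.
Qed.

(** The tent of width 2 A has area A^2, and c hardly contributes to it. Replacing ln n by ln A loses
    only for n < A, where r <= 2 and tent <= n bound the loss by the sum of 2 n ln(A / n), at most
    A^2 / 2. *)
Lemma tent_defect_log_le (s : R) K A : (0 < A)%N -> (2 * A < K)%N ->
  \sum_(n < K) c n *+ tent (2 * A) n <= s * A%:R ->
  ln A%:R * (A%:R ^+ 2 - s * A%:R) - A%:R ^+ 2 / 2 <=
  \sum_(d < K) vonMangoldt R d * (1 - c d) * (tent_sum K (2 * A) d)%:R
  + \sum_(m < K) (1 - c m) * \sum_(d < K) vonMangoldt R d *+ tent (2 * A) (d * m).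
Proof.
move=> A_gt0 ltK cT; rewrite -/r.
have leAK : (A <= K)%N by lia.
have total : tent_sum K (2 * A) 1 = (A * A)%N.
  by have := @tent_sumE A K (2 * A) 1; lia.
have lnA : 0 <= ln (A%:R : R) by rewrite ln_ge0 // ler1n.
pose t n : R := (tent (2 * A) n)%:R.
have t_ge0 n : 0 <= t n by [].
have lower : ln A%:R * (A%:R ^+ 2 - s * A%:R) - A%:R ^+ 2 / 2 <=
    \sum_(n < K) ln n%:R * (r n * t n).
  have sum_rt : A%:R ^+ 2 - s * A%:R <= \sum_(n < K) r n * t n.
    have -> : \sum_(n < K) r n * t n = (\sum_(n < K) tent (2 * A) n)%N%:R
        - \sum_(n < K) c n *+ tent (2 * A) n.
      rewrite natr_sum -sumrB; apply: eq_bigr => n _.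
      by rewrite /r /t mulrBl mul1r -[c n *+ _]mulr_natr.
    have -> : (\sum_(n < K) tent (2 * A) n = A * A)%N.
      by rewrite -total; apply: eq_bigr => n _; rewrite mul1n.
    by rewrite natrM -expr2; lra.
  have := sum_mul_ln_ratio_le R A_gt0.
  rewrite (big_ord_widen K (fun n => n%:R * (ln A%:R - ln n%:R) : R) leAK) big_mkcond /= => hA.
  have : \sum_(n < K) (ln A%:R * (r n * t n)
      - 2 * (if (n < A)%N then n%:R * (ln A%:R - ln n%:R) else 0))
      <= \sum_(n < K) ln n%:R * (r n * t n).
    apply: ler_sum => n _; have rt_ge0 : 0 <= r n * t n by rewrite mulr_ge0.
    have [ltnA|leAn] := ltnP n A; last first.
      rewrite mulr0 subr0 ler_wpM2r // ler_ln ?posrE ?ler_nat ?ltr0n //.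
      exact: leq_trans leAn.
    have [->|n_gt0] := posnP n; first by rewrite /t tent0 !mulr0 !mul0r mulr0 subrr.
    have h1 : r n * t n <= 2 * n%:R by rewrite ler_pM // ler_nat tent_le.
    have h2 : 0 <= ln A%:R - ln (n%:R : R).
      by rewrite subr_ge0 ler_ln ?posrE ?ltr0n // ler_nat ltnW.
    by have := ler_wpM2r h2 h1; lra.
  rewrite sumrB -!mulr_sumr => h.
  by have := ler_wpM2l lnA sum_rt; lra.
apply: le_trans lower _.
rewrite (@sum_ln_vonMangoldt R K (fun n => r n * t n)); last 2 first.
- by rewrite /t tent0 mulr0.
- by move=> n leKn; rewrite /t tent_eq0 ?mulr0 //; exact: leq_trans (ltnW ltK) leKn.
have -> : \sum_(m < K) r m * \sum_(d < K) vonMangoldt R d *+ tent (2 * A) (d * m)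
    = \sum_(d < K) vonMangoldt R d * \sum_(m < K) r m * t (d * m)%N.
  under eq_bigr => m _ do rewrite mulr_sumr.
  rewrite exchange_big /=; apply: eq_bigr => d _; rewrite mulr_sumr.
  apply: eq_bigr => m _; rewrite /t -[vonMangoldt R d *+ _]mulr_natr; ring.
rewrite -big_split /=; apply: ler_sum => d _.
rewrite -mulrA -mulrDr ler_wpM2l ?vonMangoldt_ge0 // natr_sum mulr_sumr -big_split /=.
apply: ler_sum => m _; rewrite -mulrDl ler_wpM2r //; exact: defect_mul_le.
Qed.

(** Using r(d) - r(m) <= r(d m) leaves a loss of r(m) times the sum over d of Lambda(d) against the
    cutoff at d m, which Mertens bounds by ln(N / m) + 1/3 times the cutoff at m. Its -ln m cancels
    the ln m of the logarithmic sum. *)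
Lemma cutoff_defect_le K N : (1 < N < K)%N ->
  \sum_(d < K) vonMangoldt R d * (1 - c d) * \sum_(m < K) cutoff R N (d * m)
  <= (ln N%:R + 1 / 3) * \sum_(m < K) (1 - c m) * cutoff R N m.
Proof.
move=> /andP[N_gt1 ltNK]; rewrite -/r.
have N_gt0 : (0 < N)%N by exact: ltnW.
have id1 := @sum_ln_vonMangoldt R K (fun n => r n * cutoff R N n).
rewrite cutoff0 mulr0 in id1.
have {}id1 : \sum_(n < K) ln n%:R * (r n * cutoff R N n) =
  \sum_(d < K) vonMangoldt R d * \sum_(m < K) r (d * m)%N * cutoff R N (d * m).
  by apply: (id1 erefl) => n leKn; rewrite cutoff_eq0 ?mulr0 // (leq_trans (ltnW ltNK)).
have lower : \sum_(d < K) vonMangoldt R d * \sum_(m < K) (r d - r m) * cutoff R N (d * m)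
   <= \sum_(n < K) ln n%:R * (r n * cutoff R N n).
  rewrite id1; apply: ler_sum => d _; rewrite ler_wpM2l ?vonMangoldt_ge0 //.
  apply: ler_sum => m _; rewrite ler_wpM2r ?cutoff_ge0 //; exact: defect_mul_ge.
have split : \sum_(d < K) vonMangoldt R d * \sum_(m < K) (r d - r m) * cutoff R N (d * m)
   = \sum_(d < K) vonMangoldt R d * r d * \sum_(m < K) cutoff R N (d * m)
     - \sum_(m < K) r m * \sum_(d < K) vonMangoldt R d * cutoff R N (d * m).
  have -> : \sum_(m < K) r m * \sum_(d < K) vonMangoldt R d * cutoff R N (d * m)
     = \sum_(d < K) vonMangoldt R d * \sum_(m < K) r m * cutoff R N (d * m).
    under eq_bigr => m _ do rewrite mulr_sumr.
    rewrite exchange_big /=; apply: eq_bigr => d _; rewrite mulr_sumr.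
    by apply: eq_bigr => m _; ring.
  rewrite -sumrB; apply: eq_bigr => d _; rewrite -mulrA -mulrBr; congr (_ * _).
  by rewrite mulr_sumr -sumrB; apply: eq_bigr => m _; ring.
rewrite {}split lerBlDr in lower; apply: le_trans lower _.
rewrite -big_split /= mulr_sumr; apply: ler_sum => m _.
rewrite mulrCA -mulrDr [leRHS]mulrCA ler_wpM2l //.
have [->|m_gt0] := posnP m.
  rewrite cutoff0 !mulr0 add0r big1 // => d _.
  by rewrite muln0 cutoff0 mulr0.
have [leNm|ltmN] := leqP N m.
  rewrite cutoff_eq0 // !mulr0 add0r big1 // => d _.
  have [->|d_gt0] := posnP d; first by rewrite vonMangoldt0 mul0r.
  by rewrite cutoff_eq0 ?mulr0 // (leq_trans leNm) // leq_pmull.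
(* The largest d with d m < N; the cutoff already vanishes at N. *)
pose n := (N.-1 %/ m)%N.
have n_gt0 : (0 < n)%N by rewrite divn_gt0 //; lia.
have len : (n * m <= N)%N by apply: leq_trans (leq_trunc_div _ _) _; exact: leq_pred.
have ltn : (N <= n.+1 * m)%N by have := @ltn_ceil N.-1 m m_gt0; rewrite -/n; lia.
have leK : (n.+1 <= K)%N.
  by apply: leq_trans ltNK; rewrite ltnS (leq_trans _ len) // leq_pmulr.
have lnn : ln (n%:R : R) <= ln N%:R - ln m%:R.
  have : ln ((n * m)%:R : R) <= ln N%:R.
    by rewrite ler_ln ?posrE ?ltr0n ?ler_nat // muln_gt0 n_gt0.
  by rewrite ln_natM //; lra.
have upper : \sum_(d < K) vonMangoldt R d * cutoff R N (d * m)
    <= (\sum_(d < n.+1) vonMangoldt R d / d%:R) * cutoff R N m.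
  pose F d := vonMangoldt R d * cutoff R N (d * m).
  rewrite -(big_mkord xpredT F) (big_cat_nat (leq0n n.+1) leK) /=.
  rewrite [X in _ + X]big_nat_cond [X in _ + X]big1 ?addr0 => [|d]; last first.
    rewrite andbT => /andP[led _]; rewrite /F cutoff_eq0 ?mulr0 //.
    by apply: leq_trans ltn _; rewrite leq_mul2r led orbT.
  rewrite big_mkord mulr_suml; apply: ler_sum => d _; rewrite /F.
  have [->|d_gt0] := posnP d; first by rewrite vonMangoldt0 !mul0r.
  by rewrite -mulrA ler_wpM2l ?vonMangoldt_ge0 // mulrC cutoff_multiple_le.
have := ler_wpM2r (cutoff_ge0 R N m) (mertens_le R n_gt0).
have := ler_wpM2r (cutoff_ge0 R N m) lnn.
by lra.
Qed.
End MultiplicativeSums.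

(** * Comparison of prime sums at two scales *)

Section Assembly.
Variable R : realType.

Lemma sum_vonMangoldt_tent_sum1 K N : (N <= K)%N ->
  \sum_(d < K) vonMangoldt R d * (tent_sum K N d)%:R = tent_log R K N.
Proof.
move=> leNK; have := @sum_vonMangoldt_tent_sum R K N 1 isT leNK.
rewrite /tent_log => h; transitivity (\sum_(d < K) vonMangoldt R d *+ tent_sum K N (d * 1)).
  by apply: eq_bigr => d _; rewrite muln1 mulr_natr.
by rewrite h; apply: eq_bigr => n _; rewrite muln1.
Qed.

Lemma cutoff_multiples_sum K N d : \sum_(m < K) cutoff R N (d * m)
  = \sum_(0 <= k < N.-1) cutoff_weight R k * (tent_sum K k.+2 d)%:R.
Proof.
rewrite /cutoff exchange_big big_mkord; apply: eq_bigr => k _.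
by rewrite natr_sum mulr_sumr; apply: eq_bigr => m _; rewrite mulr_natr.
Qed.

(** For each d, the tent sum at width 12 M is compared with those of widths between Y and M inside
    the cutoff. The excess [br] of the former, normalised as [mu], over the latter is nonnegative,
    so rho may be replaced there by 2; what is left is a sum of Lambda without rho, evaluated by
    [tent_log]. It yields 2 (Om^2 / 2 + Om ln 12) plus small errors, ln 12 being the ratio of the
    scales. *)
Lemma vonMangoldt_tent_defect_le (rho : nat -> R) K M Y
    (Om := \sum_(Y.-1 <= k < M.-1) cutoff_mass R k) :
  (forall n, 0 <= rho n <= 2) -> (200 <= Y < M)%N -> (12 * M < K)%N ->
  Om * \sum_(d < K) vonMangoldt R d * rho d * (tent_sum K (12 * M) d)%:R
  <= (6 * M)%:R ^+ 2 *
     (\sum_(d < K) vonMangoldt R d * rho d * \sum_(m < K) cutoff R M (d * m)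
      + Om ^+ 2 + 2 * Om * (ln 12 + 1 / 40)).
Proof.
move=> rho_bnd /andP[Y_ge ltYM] ltK.
have M_gt0 : (0 < M)%N by lia.
have Y1 : (Y.-1 <= M.-1)%N by lia.
have leMK : (M <= K)%N by lia.
have le12K : (12 * M <= K)%N by lia.
have le2K : (2 * M <= K)%N by lia.
have lt12 : (3 < 12 * M <= K)%N by lia.
have kI k : (Y.-1 <= k < M.-1)%N -> [/\ (200 <= k.+2)%N, (k.+2 <= M)%N & (k.+2 <= K)%N].
  by move=> /andP[h1 h2]; split; lia.
have M1S : M.-1.+1 = M by lia.
have tentle d : (d < M)%N -> (d <= tent (2 * M) d)%N by rewrite /tent; lia.
have kt k : (Y.-1 <= k)%N -> (400 <= k.+3 * 2)%N by lia.
have MR : 200 <= (M%:R : R) by rewrite ler_nat; lia.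
pose a : R := (6 * M)%:R ^+ 2.
have aE : a = 36 * M%:R ^+ 2 by rewrite /a natrM; ring.
have M2 : 0 < (M%:R ^+ 2 : R) by rewrite exprn_gt0 //; lra.
have a_gt0 : 0 < a by rewrite aE; lra.
rewrite -/a -ler_pdivrMl //.
pose L := vonMangoldt R; pose S N d : R := (tent_sum K N d)%:R.
(* A majorant of 1/d for d < M, by [tent_sum_lb] at width 12 M. The extra term is paid for by
   [tent_psi], as d is at most the tent of width 2 M at d. *)
pose mu d := S (12 * M)%N d / a + (if (d < M)%N then d%:R / (4 * a) else 0).
have S_ge0 N d : 0 <= S N d by [].
have w_ge0 k : 0 <= cutoff_weight R k by exact: ltW (cutoff_weight_gt0 R k).
have mu_ge d : S (12 * M)%N d / a <= mu d.
  by rewrite /mu lerDl; case: ifP => // _; rewrite divr_ge0 //; lra.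
pose br k d := k.+2%:R ^+ 2 / 4 * mu d - S k.+2 d.
have br_ge0 k d : (0 < d)%N -> (Y.-1 <= k < M.-1)%N -> 0 <= br k d.
  move=> d_gt0 /kI[_ lekM lekK]; have dR : 0 < (d%:R : R) by rewrite ltr0n.
  have mu_ge0 : 0 <= mu d by apply: le_trans (mu_ge d); rewrite divr_ge0 // ltW.
  have [ltdM|leMd] := ltnP d M; last first.
    rewrite /br /S tent_sum_base // ?(leq_trans lekM) //; last by rewrite (leq_trans leMd) // leq_pmull.
    rewrite (eqP (_ : (k.+2 - d)%N == 0%N)) ?subr0; last by rewrite subn_eq0 (leq_trans lekM).
    by rewrite mulr_ge0 // divr_ge0 ?sqr_ge0.
  have h1 := @tent_sum_lb K (12 * M) d d_gt0 le12K.
  have h2 := @tent_sum_ub K k.+2 d d_gt0 lekK.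
  move: h1 h2; rewrite -!(ler_nat R) natrD !natrM -/(S (12 * M)%N d) -/(S k.+2 d) => h1 h2.
  have inv : d%:R^-1 <= mu d.
    rewrite /mu ltdM -div1r ler_pdivrMr // aE.
    rewrite [leRHS](_ : _ = (4 * d%:R * S (12 * M)%N d + d%:R * d%:R) / (144 * M%:R ^+ 2)).
      by rewrite ler_pdivlMr; lra.
    by field; rewrite lt0r_neq0 //; lra.
  rewrite /br subr_ge0; apply: (@le_trans _ _ (k.+2%:R ^+ 2 / 4 * d%:R^-1)); last first.
    by rewrite ler_wpM2l // divr_ge0 ?sqr_ge0.
  by rewrite ler_pdivlMr // expr2; lra.
have pt d : Om * (S (12 * M)%N d / a) <=
    \sum_(m < K) cutoff R M (d * m) + \sum_(Y.-1 <= k < M.-1) cutoff_weight R k * br k d.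
  rewrite cutoff_multiples_sum.
  have Om_ge0 : 0 <= Om by apply: sumr_ge0 => k _; exact: ltW (cutoff_mass_gt0 R k).
  apply: (@le_trans _ _ (Om * mu d)); first by rewrite ler_wpM2l.
  have -> : \sum_(Y.-1 <= k < M.-1) cutoff_weight R k * br k d
     = Om * mu d - \sum_(Y.-1 <= k < M.-1) cutoff_weight R k * S k.+2 d.
    rewrite /Om mulr_suml -sumrB; apply: eq_bigr => k _.
    by rewrite /br cutoff_massE; ring.
  rewrite (big_cat_nat (leq0n Y.-1) Y1) /=.
  have : 0 <= \sum_(0 <= k < Y.-1) cutoff_weight R k * S k.+2 d.
    by apply: sumr_ge0 => k _; rewrite mulr_ge0.
  rewrite -[\sum_(Y.-1 <= i < M.-1) _ * (tent_sum K i.+2 d)%:R]/(\sum_(Y.-1 <= k < M.-1) cutoff_weight R k * S k.+2 d).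
  rewrite -[\sum_(0 <= i < Y.-1) _ * (tent_sum K i.+2 d)%:R]/(\sum_(0 <= k < Y.-1) cutoff_weight R k * S k.+2 d).
  by lra.
pose T := \sum_(d < K) L d * mu d.
have main : \sum_(i < K) a^-1 * (Om * (L i * rho i * S (12 * M)%N i)) <=
    \sum_(d < K) L d * rho d * \sum_(m < K) cutoff R M (d * m)
    + 2 * \sum_(Y.-1 <= k < M.-1) cutoff_weight R k * (k.+2%:R ^+ 2 / 4 * T - tent_log R K k.+2).
  have -> : \sum_(Y.-1 <= k < M.-1) cutoff_weight R k * (k.+2%:R ^+ 2 / 4 * T - tent_log R K k.+2)
     = \sum_(d < K) L d * \sum_(Y.-1 <= k < M.-1) cutoff_weight R k * br k d.
    under [RHS]eq_bigr => d _ do rewrite mulr_sumr.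
    rewrite exchange_big /= big_nat_cond [RHS]big_nat_cond; apply: eq_bigr => k.
    rewrite andbT => /kI[_ _ lekK]; rewrite -sum_vonMangoldt_tent_sum1 // /T.
    rewrite mulr_sumr -sumrB mulr_sumr; apply: eq_bigr => d _.
    by rewrite /br /S /L; ring.
  rewrite mulr_sumr -big_split /=; apply: ler_sum => d _.
  have Ld : 0 <= L d by exact: vonMangoldt_ge0.
  have /andP[rho_ge0 rho_le2] := rho_bnd d.
  have [->|d_gt0] := posnP d; first by rewrite /L vonMangoldt0 !(mul0r, mulr0) addr0.
  set Z := \sum_(Y.-1 <= k < M.-1) _.
  have Z_ge0 : 0 <= Z.
    rewrite /Z big_nat_cond; apply: sumr_ge0 => k; rewrite andbT => hk.
    by rewrite mulr_ge0 // br_ge0.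
  have LZ := mulr_ge0 Ld Z_ge0.
  have := ler_wpM2l (mulr_ge0 Ld rho_ge0) (pt d); rewrite -/Z mulrDr => h.
  have h2 : L d * rho d * Z <= 2 * (L d * Z).
    by rewrite mulrAC mulrC ler_wpM2r.
  have -> : a^-1 * (Om * (L d * rho d * S (12 * M)%N d))
    = L d * rho d * (Om * (S (12 * M)%N d / a)) by ring.
  by apply: le_trans h _; rewrite lerD2l.
have -> : a^-1 * (Om * \sum_(d < K) vonMangoldt R d * rho d * (tent_sum K (12 * M) d)%:R)
  = \sum_(i < K) a^-1 * (Om * (L i * rho i * S (12 * M)%N i)) by rewrite !mulr_sumr.
apply: le_trans main _; rewrite -addrA lerD2l.
have T_le : T <= ln M%:R + ln 12 + ln 2 - 3 / 2 + 3 / 200.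
  have T1 : T <= tent_log R K (12 * M) / a + tent_psi R K (2 * M) / (4 * a).
    rewrite -sum_vonMangoldt_tent_sum1 // /tent_psi !mulr_suml -big_split /=.
    apply: ler_sum => d _; rewrite /mu mulrDr -/(L d) -/(S (12 * M)%N d).
    have Ld : 0 <= L d by exact: vonMangoldt_ge0.
    rewrite -[L d *+ _]mulr_natr -!mulrA lerD2l ler_wpM2l //.
    case: ifP => [ltdM|_]; last by rewrite divr_ge0 //; lra.
    by rewrite ler_wpM2r ?invr_ge0 ?ler_nat ?tentle //; lra.
  have h1 := @tent_log_le R K (12 * M) lt12; have h2 := @tent_psi_le_sqr R K (2 * M) le2K.
  have ln12M : ln ((12 * M)%:R : R) = ln 12 + ln M%:R by rewrite ln_natM.
  have hln := @ln_le_subr1 R (12 * M)%:R ltac:(rewrite natrM; lra).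
  rewrite /tent_log_main ln12M natrM in h1; rewrite natrM in h2; rewrite ln12M natrM in hln.
  have q1 : tent_log R K (12 * M) / a <= ln 12 + ln M%:R + ln 2 - 3 / 2 + 1 / 200.
    rewrite ler_pdivrMr // aE; nra.
  have q2 : tent_psi R K (2 * M) / (4 * a) <= 1 / 100 by rewrite ler_pdivrMr; lra.
  by lra.
have each k : (Y.-1 <= k < M.-1)%N ->
    cutoff_weight R k * (k.+2%:R ^+ 2 / 4 * T - tent_log R K k.+2)
    <= cutoff_mass R k * (ln M%:R - ln k.+2%:R) + cutoff_mass R k * (ln 12 + 1 / 50).
  move=> /kI[ge200 lekM lekK]; rewrite -[leRHS]mulrDr cutoff_massE -[leRHS]mulrA ler_wpM2l //.
  have NR : 200 <= (k.+2%:R : R) by rewrite ler_nat.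
  have h1 := @tent_log_ge R K k.+2 lekK.
  have hln := @ln_le_subr1 R k.+2%:R ltac:(lra).
  rewrite /tent_log_main in h1; set N : R := k.+2%:R in NR h1 hln *.
  have N2 : 0 <= N ^+ 2 / 4 by rewrite divr_ge0 ?sqr_ge0.
  have := ler_wpM2l N2 T_le.
  have n2 : 200 * N <= N ^+ 2 by rewrite expr2 ler_wpM2r //; lra.
  by lra.
apply: (@le_trans _ _ (2 * (\sum_(Y.-1 <= k < M.-1) cutoff_mass R k * (ln M%:R - ln k.+2%:R)
    + Om * (ln 12 + 1 / 50)))).
  rewrite ler_wpM2l // /Om mulr_suml -big_split /= [leLHS]big_nat_cond [leRHS]big_nat_cond.
  by apply: ler_sum => k; rewrite andbT; exact: each.
have := @cutoff_mass_ln_sum R Y.-1 M.-1 (1 / 400) _ Y1; rewrite M1S -/Om => h.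
have Om_ge0 : 0 <= Om by apply: sumr_ge0 => k _; exact: ltW (cutoff_mass_gt0 R k).
have {}h := h _.
suff : \sum_(Y.-1 <= k < M.-1) cutoff_mass R k * (ln M%:R - ln k.+2%:R)
    <= Om ^+ 2 / 2 + Om * (1 / 400) by lra.
apply: h => k /kt; rewrite -(ler_nat R) natrM => h400.
by rewrite -div1r -mulrA -invfM ler_pdivrMr; lra.
Qed.
End Assembly.

(** * Roots of unity and Dirichlet kernels *)

Lemma prim_root_exists (C : numClosedFieldType) n : (0 < n)%N ->
  exists z : C, n.-primitive_root z.
Proof.
move=> n_gt0; have [r er] := closed_field_poly_normal ('X^n - 1 : {poly C}).
rewrite (monicP (monicXnsubC _ n_gt0)) scale1r in er.
have sz : (n <= size r)%N by rewrite -ltnS -(size_prod_XsubC r id) -er size_XnsubC.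
have unity : all n.-unity_root r by apply/allP => z; rewrite -root_prod_XsubC -er.
have : uniq r.
  by rewrite -separable.separable_prod_XsubC -er cyclotomic.separable_Xn_sub_1 // pnatr_eq0 -lt0n.
by move=> /(cyclic.has_prim_root n_gt0 unity) /(_ sz) /hasP[z _ zP]; exists z.
Qed.

Section RootsOfUnity.
Variables (C : numClosedFieldType) (q : nat) (z : C).
Hypotheses (q_gt1 : (1 < q)%N) (zP : q.-primitive_root z).

Let q_gt0 : (0 < q)%N. Proof. exact: ltnW. Qed.

Lemma prim_root_norm k : `|z ^+ k| = 1.
Proof.
have : `|z| ^+ q = 1 by rewrite -normrX (prim_expr_order zP) normr1.
rewrite normrX => /eqP; rewrite pexpr_eq1 ?normr_ge0 // => /eqP ->; exact: expr1n.
Qed.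

Lemma prim_root_conj k : (z ^+ k)^*%R = z ^+ (k * q.-1).
Proof.
have zk_neq0 : z ^+ k != 0 by rewrite -normr_eq0 prim_root_norm oner_eq0.
apply: (mulfI zk_neq0); rewrite -normCK prim_root_norm expr1n -exprD -mulnS prednK //.
by rewrite mulnC exprM (prim_expr_order zP) expr1n.
Qed.

Lemma prim_root_sum k : \sum_(a < q) z ^+ (a * k) = if (q %| k)%N then q%:R else 0.
Proof.
under eq_bigr => a _ do rewrite mulnC exprM.
case: ifP => [/dvdnP[j ->]|ndvd].
  rewrite (eq_bigr (fun=> 1)) ?sumr_const ?card_ord // => a _.
  by rewrite mulnC exprM (prim_expr_order zP) !expr1n.
have neq1 : z ^+ k - 1 != 0 by rewrite subr_eq0 -(prim_order_dvd zP) ndvd.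
by apply: (mulfI neq1); rewrite -subrX1 mulr0 -exprM mulnC exprM (prim_expr_order zP) expr1n subrr.
Qed.

Let D A (a : nat) := \sum_(i < A) z ^+ (a * i).

Let dirichlet_kernel_period A k a : ~~ (q %| a)%N -> D (k * q + A) a = D A a.
Proof.
move=> ndvd; elim: k => [|k IHk]; first by rewrite mul0n add0n.
rewrite mulSn -addnA -IHk /D big_split_ord /=.
have -> : \sum_(i < q) z ^+ (a * i) = 0.
  by under eq_bigr => i _ do rewrite mulnC; rewrite prim_root_sum (negbTE ndvd).
rewrite add0r; apply: eq_bigr => i _; rewrite mulnDr exprD mulnC exprM.
by rewrite (prim_expr_order zP) expr1n mul1r.
Qed.

Let dirichlet_kernel_sqr A : (A < q)%N -> \sum_(a < q) `|D A a| ^+ 2 = q%:R * A%:R.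
Proof.
move=> ltAq.
have -> : \sum_(a < q) `|D A a| ^+ 2 =
    \sum_(i < A) \sum_(j < A) \sum_(a < q) z ^+ (a * (i + j * q.-1)).
  under eq_bigr => a _ do rewrite normCK /D rmorph_sum big_distrlr /=.
  rewrite exchange_big /=; apply: eq_bigr => i _; rewrite exchange_big /=.
  apply: eq_bigr => j _; apply: eq_bigr => a _.
  by rewrite prim_root_conj -exprD mulnDr mulnA.
have -> : \sum_(i < A) \sum_(j < A) \sum_(a < q) z ^+ (a * (i + j * q.-1))
    = \sum_(i < A) q%:R.
  apply: eq_bigr => i _; rewrite (bigD1 i) //= prim_root_sum.
  have -> : (q %| i + i * q.-1)%N by rewrite -mulnS prednK // dvdn_mull.
  rewrite big1 ?addr0 // => j ne_ji; rewrite prim_root_sum.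
  case: ifP => // dvd; case/eqP: ne_ji; apply: val_inj => /=.
  have lti := ltn_trans (ltn_ord i) ltAq; have ltj := ltn_trans (ltn_ord j) ltAq.
  have : (i + j * q.-1 + j = j %[mod q])%N by rewrite -modnDml (eqP dvd).
  have -> : (i + j * q.-1 + j = i + j * q)%N by rewrite -addnA -mulnSr prednK.
  by rewrite addnC modnMDl !modn_small // => ->.
by rewrite sumr_const card_ord mulr_natr.
Qed.

(** Away from a = 0 the kernel is periodic in A, so A may be reduced modulo q before Parseval is
    applied. At a = 0 the kernel is A itself, so that term must be left out. *)
Lemma dirichlet_kernel_sqr_le A :
  \sum_(a < q | (0 < a)%N) `|\sum_(i < A) z ^+ (a * i)| ^+ 2 <= q%:R * A%:R.
Proof.
have eA := divn_eq A q; have ltA := ltn_pmod A q_gt0.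
apply: (@le_trans _ _ (q%:R * (A %% q)%N%:R)); last first.
  by rewrite ler_wpM2l // ler_nat leq_mod.
rewrite -dirichlet_kernel_sqr // [leRHS](bigID (fun a : 'I_q => (0 < a)%N)) /=.
apply: ler_wpDr; first by apply: sumr_ge0 => a _; rewrite exprn_ge0.
apply: ler_sum => a a_gt0; rewrite -(@dirichlet_kernel_period (A %% q) (A %/ q)) -?eA //.
by apply/negP => /(dvdn_leq a_gt0); rewrite leqNgt ltn_ord.
Qed.
End RootsOfUnity.

(** * The Gauss sum of a primitive quadratic character *)

Section GaussSum.
Variables (R : realType) (q : nat) (chi : int -> R[i]).
Hypotheses (hchi : dirichlet_character q chi) (hprim : primitive_character q chi).
Hypotheses (hquad : quadratic_character q chi) (q_gt1 : (1 < q)%N).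

Let q_gt0 : (0 < q)%N. Proof. exact: ltnW. Qed.

Let chiM a b : chi (a * b) = chi a * chi b. Proof. by case: hchi. Qed.

Let chi_neq0 a : (chi a != 0) = coprimez a q%:Z. Proof. by case: hchi. Qed.

Lemma dirichlet_character1 : chi 1 = 1.
Proof.
have n0 : chi 1 != 0 by rewrite chi_neq0 coprimezE coprime1n.
by apply: (mulfI n0); rewrite mulr1 -chiM mulr1.
Qed.

Lemma dirichlet_character_modn n : chi (n %% q)%N%:Z = chi n%:Z.
Proof.
case: hchi => _ _ per _; rewrite {2}(divn_eq n q).
elim: (n %/ q)%N => [|k IHk]; first by rewrite mul0n add0n.
by rewrite mulSn addnAC -addnA PoszD addrC per addnC.
Qed.

Lemma dirichlet_character_modz (a : int) : chi (a %% q%:Z)%Z = chi a.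
Proof.
case: hchi => _ _ per _; rewrite {2}(divz_eq a q%:Z).
have perz (k : nat) b : chi (b + k%:Z * q%:Z) = chi b.
  elim: k => [|k IHk]; first by rewrite mul0r addr0.
  by rewrite -addn1 PoszD mulrDl mul1r addrA per.
rewrite addrC; case: (a %/ q%:Z)%Z => k; first by rewrite perz.
by rewrite NegzE -[RHS](perz k.+1) mulNr subrK.
Qed.

Let chi_real a : chi a \is Num.real. Proof. by case: hquad => + _; apply. Qed.

(** By Euler's theorem the value is a root of unity, so it has modulus 1; being real, it squares to
    1. *)
Lemma quadratic_character_sqr a : coprimez a q%:Z -> chi a ^+ 2 = 1.
Proof.
move=> cop; pose u := absz (a %% q%:Z)%Z.
have uE : u%:Z = (a %% q%:Z)%Z by rewrite /u gez0_abs // modz_ge0 // eqz_nat -lt0n.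
have chiu : chi u%:Z = chi a by rewrite uE dirichlet_character_modz.
have copu : coprime u q.
  by have := chi_neq0 u%:Z; rewrite chiu chi_neq0 cop coprimezE /= => <-.
have chiX k : chi (u ^ k)%N%:Z = chi u%:Z ^+ k.
  elim: k => [|k IHk]; first by rewrite expn0 dirichlet_character1.
  by rewrite expnS PoszM chiM IHk exprS.
have tot : chi u%:Z ^+ totient q = 1.
  rewrite -chiX -dirichlet_character_modn (cyclic.Euler_exp_totient copu).
  by rewrite modn_small // dirichlet_character1.
have : `|chi u%:Z| ^+ totient q == 1 by rewrite -normrX tot normr1.
rewrite pexpr_eq1 ?totient_gt0 // => /eqP nrm.
by rewrite -chiu -real_normK // nrm expr1n.
Qed.

Lemma quadratic_character_norm a : `|chi a| <= 1.
Proof.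
have [->|] := eqVneq (chi a) 0; first by rewrite normr0.
rewrite chi_neq0 => /quadratic_character_sqr e.
by rewrite -(@expr_le1 _ 2) // -normrX e normr1.
Qed.

Variable z : R[i].
Hypothesis zP : q.-primitive_root z.

Let G n := \sum_(a < q) chi a%:Z * z ^+ (a * n).

Let gauss_twist u n : coprime u q -> G n = chi u%:Z * G (u * n)%N.
Proof.
move=> cop; pose h (a : 'I_q) : 'I_q := Ordinal (ltn_pmod (u * a) q_gt0).
have h_inj : injective h.
  move=> a b [] e; apply: val_inj => /=; pose v := (u ^ (totient q).-1)%N.
  have vu : (v * u = 1 %[mod q])%N.
    by rewrite -expnSr prednK ?totient_gt0 // (cyclic.Euler_exp_totient cop).
  have : (v * (u * a) = v * (u * b) %[mod q])%N by rewrite -modnMmr e modnMmr.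
  by rewrite !mulnA -modnMml vu modnMml mul1n -[RHS]modnMml vu modnMml mul1n !modn_small.
rewrite /G (reindex_inj h_inj) /= mulr_sumr; apply: eq_bigr => a _.
rewrite dirichlet_character_modn PoszM chiM -mulrA; congr (_ * (_ * _)).
by rewrite exprM (prim_expr_mod zP) -exprM mulnAC mulnC.
Qed.

(** If d > 1 divides both n and q, primitivity provides a unit a = 1 mod q/d with chi(a) <> 1. Then
    a n = n mod q, so G n = chi(a) G n. *)
Let gauss_noncoprime n : ~~ coprime n q -> G n = 0.
Proof.
move=> ncop; pose d := gcdn n q; pose q1 := (q %/ d)%N.
have d_gt0 : (0 < d)%N by rewrite gcdn_gt0 q_gt0 orbT.
have d_gt1 : (1 < d)%N by rewrite ltn_neqAle d_gt0 andbT eq_sym.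
have eq1 : (q1 * d = q)%N by rewrite divnK // dvdn_gcdr.
have en : (n %/ d * d = n)%N by rewrite divnK // dvdn_gcdl.
have ne : q1 <> q.
  move=> e; move: eq1; rewrite e => /eqP; rewrite -{2}[q]muln1 eqn_pmul2l // => /eqP d1.
  by rewrite d1 in d_gt1.
have [a [cop a1 chia]] : exists a, [/\ coprimez a q%:Z, (a = 1 %[mod q1%:Z])%Z & chi a <> 1].
  apply: contrapT => none; apply: ne; apply: hprim; split.
    by rewrite -eq1 dvdn_mulr.
  by move=> a cop a1; apply: contrapT => chia; apply: none; exists a.
pose u := absz (a %% q%:Z)%Z.
have uE : u%:Z = (a %% q%:Z)%Z by rewrite /u gez0_abs // modz_ge0 // eqz_nat -lt0n.
have chiu : chi u%:Z = chi a by rewrite uE dirichlet_character_modz.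
have copu : coprime u q.
  by have := chi_neq0 u%:Z; rewrite chiu chi_neq0 cop coprimezE /= => <-.
have u1 : (u = 1 %[mod q1])%N.
  have : (u%:Z = 1 %[mod q1%:Z])%Z.
    rewrite -a1 uE; apply/eqP; rewrite eqz_mod_dvd.
    have : (q%:Z %| (a %% q%:Z)%Z - a)%Z by rewrite -eqz_mod_dvd modz_mod.
    by apply: dvdz_trans; rewrite dvdzE /= -eq1 dvdn_mulr.
  by rewrite !modz_nat => -[].
have unE : (u * n = n %[mod q])%N.
  rewrite -en -eq1 mulnA -!muln_modl; congr (_ * _)%N.
  by rewrite -modnMml u1 modnMml mul1n.
have := gauss_twist n copu.
have -> : G (u * n)%N = G n.
  apply: eq_bigr => b _; congr (_ * _).
  by rewrite -(prim_expr_mod zP) -modnMmr unE modnMmr (prim_expr_mod zP).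
rewrite chiu => e; apply/eqP; apply: contraT => Gn0.
by case: chia; apply: (mulIf Gn0); rewrite mul1r -e.
Qed.

Lemma gauss_sumE n : G n = chi n%:Z * G 1%N.
Proof.
have [cop|ncop] := boolP (coprime n q).
  rewrite (gauss_twist 1 cop) muln1 mulrA -expr2 quadratic_character_sqr ?mul1r //.
rewrite gauss_noncoprime //; have := chi_neq0 n%:Z; rewrite coprimezE /= (negbTE ncop).
by move=> /negbFE /eqP ->; rewrite mul0r.
Qed.

(** Expanding the conjugate factor and absorbing chi(a) through [gauss_sumE] leaves complete sums of
    roots of unity; the condition that q divides b + q - 1 selects b = 1. *)
Lemma gauss_sum_norm : `|G 1%N| ^+ 2 = q%:R.
Proof.
rewrite normCK {2}/G rmorph_sum /= mulr_sumr.
under eq_bigr => a _.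
  rewrite rmorphM /= (CrealP (chi_real _)) (prim_root_conj q_gt1 zP) muln1 mulrA.
  rewrite [G 1%N * _]mulrC -gauss_sumE /G mulr_suml.
  under eq_bigr => b _ do rewrite -mulrA -exprD [(b * a)%N]mulnC -mulnDr.
  over.
rewrite exchange_big /=.
under eq_bigr => b _ do rewrite -mulr_sumr (prim_root_sum zP).
rewrite (bigD1 (Ordinal q_gt1)) //= add1n prednK // dvdnn dirichlet_character1 mul1r.
rewrite big1 ?addr0 // => b ne_b; case: ifP => [dvd|_]; last by rewrite mulr0.
case/eqP: ne_b; apply: val_inj => /=.
have := ltn_ord b; move: dvd => /dvdnP[k ek] ltb.
have : (k = 0 \/ k = 1 \/ 1 < k)%N by lia.
by move=> [k0|[k1|k2]]; [|move: ek; rewrite k1; lia|]; nia.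
Qed.
End GaussSum.

(** * The contradiction from a large value of the series *)

Lemma truncn_exists (R : realType) (x : R) : 0 <= x ->
  exists n : nat, n%:R <= x < n%:R + 1.
Proof.
by move=> x_ge0; exists (Num.truncn x); have := truncn_itv x_ge0; rewrite -natr1.
Qed.

Lemma ln_le_mono (R : realType) (x y : R) : 0 < x -> x <= y -> ln x <= ln y.
Proof. by move=> x_gt0 lexy; rewrite ler_ln ?posrE // (lt_le_trans x_gt0). Qed.

Lemma lnMpos (R : realType) (x y : R) : 0 < x -> 0 < y -> ln (x * y) = ln x + ln y.
Proof. by move=> x_gt0 y_gt0; rewrite lnM ?posrE. Qed.

Theorem log_series_bound (R : realType) (c : nat -> R) (s L : R) :
  (forall m n, c (m * n)%N = c m * c n) -> (forall n, -1 <= c n <= 1) ->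
  (forall K N, (N <= K)%N -> \sum_(n < K) c n *+ tent N n <= s * N%:R / 2) ->
  (forall K N, (1 < N <= K)%N -> L <= \sum_(n < K) c n * cutoff R N n + 2 * s / N%:R) ->
  0 < s -> 113 / 2 <= ln s -> L <= 9 / 10 * ln s.
Proof.
move=> cM c_bound cT cL s_gt0 ln_s; rewrite leNgt; apply/negP => L_gt.
have s_ge : 57 <= s.
  by have := expR_ge1Dx (ln s); rewrite lnK ?posrE //; lra.
(* The factor 5 balances the error 2 s / M in [D_le] against the growth of ln M. At width 12 M the
   relative error s / (6 M) of the character tent is at most 41/1200. *)
have [M /andP[M_le M_gt]] := @truncn_exists R (5 * s) ltac:(lra).
have MR : 200 <= (M%:R : R) by lra.
have M_ge : (200 <= M)%N by rewrite -(ler_nat R).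
have [[/andP[l2lo l2up] /andP[l3lo l3up] /andP[l5lo l5up] _] _] := ln_small_bounds R.
pose l : R := ln M%:R.
have l_le : l <= ln 5 + ln s.
  by rewrite -lnMpos //; apply: ln_le_mono; lra.
have sM : s <= 41 / 200 * M%:R by lra.
have l_ge58 : 58 <= l.
  have h : 50 / 51 * (5 * s) <= M%:R by lra.
  have q0 : 0 < 50 / 51 :> R by lra.
  have lq : - (1 / 50) <= ln (50 / 51 : R).
    by apply: le_trans (ln_ge_1BV q0); rewrite invf_div; lra.
  have e1 : ln (50 / 51 * (5 * s)) = ln (50 / 51) + ln (5 * s) by apply: lnMpos => //; lra.
  have e2 : ln (5 * s) = ln 5 + ln s by apply: lnMpos.
  have : ln (50 / 51 * (5 * s)) <= l by apply: ln_le_mono; lra.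
  by rewrite e1 e2; move: (ln (50 / 51)) lq => t lq; lra.
have expl : expR l = M%:R by rewrite lnK ?posrE; lra.
have e_ge : 300 <= expR (16 / 25 * l).
  have -> : 16 / 25 * l = 8 / 25 * l + 8 / 25 * l by lra.
  rewrite expRD; have := expR_ge1Dx (8 / 25 * l).
  by move: (expR _) => y h; nra.
(* This makes Om about 9 l / 25. The later bound (l / Om) D(M) + Om is least at Om = sqrt(l D(M));
   near l = 58, where D(M) is at most about l / 10 + 5/3, this is close to 9 l / 25. *)
have [Y /andP[Y_le Y_gt]] := @truncn_exists R (expR (16 / 25 * l)) ltac:(lra).
have YR : 200 <= (Y%:R : R) by lra.
have ltYM : (Y < M)%N.
  by rewrite -(ltr_nat R) -expl (le_lt_trans Y_le) // ltr_expR; lra.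
have Y_ge : (200 <= Y)%N by rewrite -(ler_nat R).
have lnY_le : ln (Y%:R : R) <= 16 / 25 * l.
  by rewrite -[leRHS]expRK; apply: ln_le_mono; lra.
have lnY_ge : 16 / 25 * l - 1 / 200 <= ln (Y%:R : R).
  have h1 : 16 / 25 * l <= ln (Y%:R + 1 : R).
    by rewrite -[leLHS]expRK; apply: ln_le_mono; [exact: expR_gt0 | lra].
  have Y0 : 0 < (Y%:R : R) by lra.
  have Y10 : 0 < (Y%:R + 1 : R) by lra.
  have h2 := ln_le_subr1 (divr_gt0 Y10 Y0); rewrite ln_div ?posrE // in h2.
  have h3 : (Y%:R + 1) / Y%:R <= 201 / 200 :> R by rewrite ler_pdivrMr; lra.
  lra.
have Y1S : Y.-1.+1 = Y by rewrite prednK // (leq_trans _ Y_ge).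
have M1S : M.-1.+1 = M by rewrite prednK // (leq_trans _ M_ge).
have YM1 : (Y.-1 <= M.-1)%N by rewrite -ltnS Y1S M1S ltnW // ltnS.
pose K := (12 * M).+1; pose D N := \sum_(m < K) (1 - c m) * cutoff R N m.
have e12 : (2 * (6 * M) = 12 * M)%N by rewrite mulnA.
have e3 : (3 * (4 * M) = 12 * M)%N by rewrite mulnA.
have e8 : (2 * (4 * M) = 8 * M)%N by rewrite mulnA.
have M_gt0 : (0 < M)%N by exact: leq_trans M_ge.
have leM c1 : (c1 <= 12)%N -> (c1 * M <= K)%N.
  by move=> le12; rewrite leqW // leq_mul2r le12 orbT.
have D_le N : (100 <= N <= K)%N -> D N <= ln N%:R - 1 / 5 + 2 * s / N%:R - L.
  move=> /andP[N_ge leNK].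
  have := cL K N; rewrite leNK (leq_trans _ N_ge) // => /(_ isT) h.
  have := @cutoff_sum_le R K N N_ge leNK.
  have -> : D N = \sum_(m < K) cutoff R N m - \sum_(m < K) c m * cutoff R N m.
    by rewrite -sumrB; apply: eq_bigr => m _; rewrite mulrBl mul1r.
  by lra.
have r_ge0 n : 0 <= 1 - c n by have := c_bound n; lra.
have D_ge0 N : 0 <= D N by apply: sumr_ge0 => m _; rewrite mulr_ge0 ?cutoff_ge0.
pose a : R := (6 * M)%:R ^+ 2; pose X := \sum_(d < K) vonMangoldt R d * (1 - c d)
  * (tent_sum K (12 * M) d)%:R.
have aE : a = 36 * M%:R ^+ 2 by rewrite /a natrM; ring.
have a_gt0 : 0 < a by rewrite aE mulr_gt0 // exprn_gt0 //; lra.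
(* The width 12 M plays two parts: 2 A with A = 6 M for the defect sum, and 3 B with B = 4 M for the
   sums over multiples, which is where the cutoff at 2 B = 8 M comes from. *)
have i1 : ln (6 * M)%:R * (a - s * (6 * M)%:R) - a / 2 <= X + 11 / 10 * a * D (8 * M)%N.
  have h := @tent_defect_log_le R c cM c_bound s K (6 * M).
  rewrite e12 muln_gt0 M_gt0 in h; have {}h := h isT (ltnSn _).
  have cT12 : \sum_(n < K) c n *+ tent (12 * M) n <= s * (6 * M)%:R.
    have := cT K (12 * M)%N (leqnSn _); rewrite -{2}e12 natrM.
    by move: (\sum_(n < K) _) => t; lra.
  apply: le_trans (h cT12) _; rewrite lerD2l /D mulr_sumr; apply: ler_sum => m _.
  rewrite mulrCA ler_wpM2l //; have [->|m_gt0] := posnP m.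
    rewrite cutoff0 mulr0 big1 // => d _; by rewrite muln0 tent0.
  have B_gt0 : (0 < 4 * M)%N by rewrite muln_gt0.
  have := @vonMangoldt_tent_multiple_le R K (4 * M) m B_gt0 m_gt0.
  rewrite e3 e8 => /(_ (ltnSn _)); rewrite (_ : 9 * (4 * M)%:R ^+ 2 / 4 = a :> R) //.
  by rewrite aE natrM; field.
have i2 := @cutoff_defect_le R c cM c_bound K M.
have ltMK : (1 < M < K)%N.
  by rewrite (leq_trans _ M_ge) //= ltnS leq_pmull.
have {}i2 := i2 ltMK.
have rho_bnd n : 0 <= 1 - c n <= 2 by have := c_bound n; lra.
have YM : (200 <= Y < M)%N by rewrite Y_ge.
have i3 := @vonMangoldt_tent_defect_le R (fun n => 1 - c n) K M Y rho_bnd YM (ltnSn _).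
rewrite -/X -/a -/(D M) in i2 i3; rewrite -/l in i2.
have o_le := @cutoff_mass_sum_ub R Y.-1 M.-1 YM1.
have o_ge := @cutoff_mass_sum_lb R Y.-1 M.-1 YM1.
rewrite Y1S M1S -/l in o_le o_ge.
set Om := \sum_(Y.-1 <= k < M.-1) _ in i3 o_le o_ge.
have o_lb : 9 / 25 * l - 1 / 400 <= Om.
  have h1 : (Y.+1%:R : R)^-1 <= 200^-1 by rewrite lef_pV2 ?posrE ?ltr0n // ler_nat leqW.
  have h2 : 0 <= (M.+1%:R : R)^-1 by rewrite invr_ge0.
  by move: (Y.+1%:R^-1) (M.+1%:R^-1) h1 h2 o_ge => y1 y2 h1 h2 o_ge; lra.
have o_ub : Om <= 9 / 25 * l + 1 / 200 by lra.
have Om_gt0 : 0 < Om by lra.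
have sM0 : 2 * s / M%:R <= 41 / 100 by rewrite ler_pdivrMr; lra.
have D0 := D_le M; rewrite (leq_trans _ M_ge) // ltnW ?(andP ltMK).2 // in D0.
have {}D0 := D0 isT; rewrite -/l in D0.
have ln8M : ln ((8 * M)%:R : R) = ln 2 + (ln 2 + ln 2) + l.
  by rewrite ln_natM // -(@ln_natM R 2 2) // -(@ln_natM R 2 4).
have ln6M : ln ((6 * M)%:R : R) = ln 2 + ln 3 + l.
  by rewrite ln_natM // -(@ln_natM R 2 3).
have ln12 : ln (12 : R) = ln 2 + (ln 2 + ln 3).
  by rewrite -(@ln_natM R 2 3) // -(@ln_natM R 2 6).
have D8 := D_le (8 * M)%N; rewrite leM // andbT in D8.
have M100 : (100 <= M)%N by exact: leq_trans M_ge.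
have {}D8 := D8 (leq_trans M100 (leq_pmull M (isT : (0 < 8)%N))).
have sM8 : 2 * s / (8 * M)%:R <= 1 / 19 by rewrite natrM ler_pdivrMr; lra.
rewrite ln8M in D8.
pose x := X / a; have Xx : X = x * a by rewrite /x divfK // lt0r_neq0.
have i1' : (ln 2 + ln 3 + l) * (1 - 41 / 1200) - 1 / 2 <= x + 11 / 10 * D (8 * M)%N.
  rewrite -(ler_pM2r a_gt0); move: i1; rewrite ln6M Xx => i1.
  have h : s * (6 * M)%:R <= 41 / 1200 * a.
    by rewrite aE natrM; have := ler_wpM2r (ltW (lt_le_trans _ MR)) sM; nra.
  have l6 : 0 <= ln 2 + ln 3 + l by lra.
  have := ler_wpM2l l6 h; lra.
have i3' : Om * x <= Om * (14 / 5 * D M + Om + 2 * (ln 12 + 1 / 40)).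
  rewrite -(ler_pM2r a_gt0) (_ : Om * x * a = Om * X); last by rewrite Xx mulrA.
  apply: le_trans i3 _; rewrite [leLHS]mulrC; apply: ler_wpM2r; first exact: ltW.
  (* The ratio l / Om is about 25/9, rounded up to 14/5 to absorb the 1/3. *)
  have h : (l + 1 / 3) * D M <= 14 / 5 * Om * D M by rewrite ler_wpM2r //; lra.
  by apply: le_trans (lerD (lerD (le_trans i2 h) (lexx _)) (lexx _)) _; lra.
rewrite (ler_pM2l Om_gt0) in i3'; rewrite ln12 in i3'.
clear i1 i2 i3 Xx o_le o_ge ln8M ln6M ln12 expl e_ge Y_le Y_gt lnY_le lnY_ge D_le cT cL cM.
clearbody x Om a X l; move: (D M) (D (8 * M)%N) D0 D8 i1' i3' => d0 d8 D0 D8 i1' i3'.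
lra.
Qed.

(** * Sums of the character against tents and Lipschitz weights *)

Section CharacterSums.
Variables (R : realType) (q : nat) (chi : int -> R[i]).
Hypotheses (hchi : dirichlet_character q chi) (hprim : primitive_character q chi).
Hypotheses (hquad : quadratic_character q chi) (q_gt1 : (1 < q)%N).

Definition real_character (n : nat) : R := complex.Re (chi n%:Z).
Local Notation c := real_character.

Lemma real_characterE n : chi n%:Z = (c n)%:C.
Proof. by case: hquad => + _ => /(_ n%:Z) h; rewrite RRe_real. Qed.

Lemma real_characterM m n : c (m * n) = c m * c n.
Proof.
apply: complexI; rewrite rmorphM /= -!real_characterE PoszM.
by case: hchi.
Qed.

Lemma norm_real_complex (t : R) : `|t%:C| = `|t|%:C :> R[i].
Proof. by rewrite normc_def /= expr0n /= addr0 sqrtr_sqr. Qed.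

Lemma real_character_bound n : -1 <= c n <= 1.
Proof.
have := quadratic_character_norm hchi hquad q_gt1 n%:Z.
by rewrite real_characterE norm_real_complex -[1]/(1%:C) lecR ler_norml.
Qed.

(** The Gauss sum times the tent sum is a sum over a of chi(a) z^a times two Dirichlet kernels of
    lengths A and B with A + B = N. The inequality 2 x y <= x^2 + y^2 and Parseval bound it by q N /
    2, and the Gauss sum has modulus sqrt(q). *)
Lemma norm_tent_character_sum K N : (N <= K)%N ->
  `|\sum_(n < K) c n *+ tent N n| <= Num.sqrt q%:R * N%:R / 2.
Proof.
move=> leNK; have [z zP] := prim_root_exists R[i] (ltnW q_gt1).
pose A := N./2; pose B := (N - A)%N.
have AB : (A <= B <= A.+1)%N by rewrite /B /A; lia.
have eN : N = (A + B)%N by rewrite /B /A; lia.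
have gE := gauss_sumE hchi hprim hquad q_gt1 zP.
have gN := gauss_sum_norm hchi hprim hquad q_gt1 zP.
set tau := (\sum_(a < q) chi a%:Z * z ^+ (a * 1)) in gE gN.
pose D M (a : nat) := \sum_(i < M) z ^+ (a * i).
pose S := \sum_(n < K) chi n%:Z *+ tent N n.
have SE : tau * S = \sum_(a < q) chi a%:Z * z ^+ a * (D A a * D B a).
  rewrite /S eN (sum_tent_pairs (fun n => chi n%:Z)) // -?eN // mulr_sumr.
  under eq_bigr => i _.
    rewrite mulr_sumr.
    under eq_bigr => j _ do rewrite mulrC -gE.
    rewrite exchange_big /=.
    over.
  rewrite exchange_big /=; apply: eq_bigr => a _; rewrite /D big_distrlr mulr_sumr /=.
  apply: eq_bigr => i _; rewrite mulr_sumr; apply: eq_bigr => j _.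
  by rewrite -mulrA -!exprD; congr (_ * z ^+ _); lia.
have norm_le : `|tau| * `|S| <= q%:R * N%:R / 2.
  rewrite -normrM SE (bigID (fun a : 'I_q => (0 < a)%N)) /= [X in _ + X]big1 ?addr0; last first.
    move=> a; rewrite -eqn0Ngt => /eqP ->.
    have : (chi 0%N%:Z != 0) = false.
      by case: hchi => _ _ _ ->; rewrite coprimezE /= /coprime gcd0n gtn_eqF.
    by move=> /negbFE /eqP ->; rewrite !mul0r.
  apply: le_trans (ler_norm_sum _ _ _) _.
  apply: (@le_trans _ _ (\sum_(a < q | (0 < a)%N) (`|D A a| ^+ 2 + `|D B a| ^+ 2) / 2)).
    apply: ler_sum => a _; rewrite !normrM (prim_root_norm q_gt1 zP) mulr1.
    apply: (@le_trans _ _ (`|D A a| * `|D B a|)).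
      by rewrite ler_piMl ?mulr_ge0 // (quadratic_character_norm hchi hquad q_gt1).
    rewrite -subr_ge0.
    have -> : (`|D A a| ^+ 2 + `|D B a| ^+ 2) / 2 - `|D A a| * `|D B a|
        = (`|D A a| - `|D B a|) ^+ 2 / 2 by field.
    rewrite divr_ge0 // real_exprn_even_ge0 // rpredB // normr_real //.
  rewrite -mulr_suml ler_wpM2r ?invr_ge0 // big_split /=.
  rewrite [in N%:R]eN natrD mulrDr lerD //; exact: dirichlet_kernel_sqr_le.
have SR : S = (\sum_(n < K) c n *+ tent N n)%:C.
  by rewrite rmorph_sum; apply: eq_bigr => n _; rewrite rmorphMn /= real_characterE.
have tauE : `|tau| = (Num.sqrt q%:R)%:C.
  apply/eqP; rewrite -(@eqrXn2 _ 2) ?normr_ge0 //; last by rewrite -[0]/(0%:C) lecR sqrtr_ge0.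
  by rewrite gN -rmorphXn /= sqr_sqrtr // rmorph_nat.
have sq_gt0 : 0 < Num.sqrt (q%:R : R) by rewrite sqrtr_gt0 ltr0n ltnW.
rewrite -(ler_pM2l sq_gt0) -lecR rmorphM /= -tauE -norm_real_complex -SR.
apply: le_trans norm_le _; rewrite -[X in X * _ / 2]gN tauE.
rewrite -[2]/(2%:R) -(rmorph_nat (real_complex R)) -(rmorph_nat (real_complex R) 2).
rewrite -fmorphV -rmorphXn -!rmorphM /= lecR; lra.
Qed.

Let P m := \sum_(n < m) c n.

(** This crude bound, from periodicity and a vanishing complete sum, serves only the convergence of
    the series. *)
Lemma norm_character_sum m : `|P m| <= q%:R.
Proof.
have q_gt0 : (0 < q)%N by exact: ltnW.
have [z zP] := prim_root_exists R[i] q_gt0.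
have cmod n : c (n %% q) = c n by rewrite /c (dirichlet_character_modn hchi).
have full : \sum_(n < q) c n = 0.
  apply: complexI; rewrite rmorph_sum /= rmorph0.
  have := gauss_sumE hchi hprim hquad q_gt1 zP 0.
  have -> : chi 0%N%:Z = 0.
    apply/eqP; have : (chi 0%N%:Z != 0) = false.
      by case: hchi => _ _ _ ->; rewrite coprimezE /= /coprime gcd0n gtn_eqF.
    by move/negbFE.
  rewrite mul0r => e; rewrite -[RHS]e; apply: eq_bigr => a _.
  by rewrite muln0 expr0 mulr1 real_characterE.
have period k j : P (k * q + j) = P j.
  elim: k => [|k IHk]; first by rewrite mul0n.
  rewrite -IHk mulSn -addnA /P big_split_ord /= full add0r.
  by apply: eq_bigr => i _; rewrite -cmod modnDl cmod.
rewrite (divn_eq m q) period; apply: le_trans (ler_norm_sum _ _ _) _.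
apply: (@le_trans _ _ (\sum_(i < m %% q) 1)).
  by apply: ler_sum => i _; rewrite ler_norml real_character_bound.
by rewrite sumr_const card_ord ler_nat ltnW // ltn_pmod.
Qed.

(** Summation by parts; the boundary term and the sum of increments are each at most q m. *)
Lemma norm_lipschitz_character_sum (h : nat -> R) m : h 0%N = 0 ->
  (forall n, `|h n.+1 - h n| <= 1) -> `|\sum_(n < m) c n * h n| <= 2 * q%:R * m%:R.
Proof.
move=> h0 hL.
have abel : \sum_(n < m) c n * h n = P m * h m - \sum_(n < m) P n.+1 * (h n.+1 - h n).
  elim: m => [|m IHm]; first by rewrite !big_ord0 h0 mulr0 subrr.
  rewrite !big_ord_recr /= IHm.
  have -> : P m.+1 = P m + c m by rewrite /P big_ord_recr.
  ring.
have hm : `|h m| <= m%:R.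
  elim: {abel} m => [|m IHm]; first by rewrite h0 normr0.
  have -> : h m.+1 = (h m.+1 - h m) + h m by ring.
  by apply: le_trans (ler_normD _ _) _; rewrite -[m.+1%:R]natr1 addrC lerD.
rewrite abel (le_trans (ler_normB _ _)) //.
have -> : 2 * q%:R * m%:R = q%:R * m%:R + m%:R * q%:R :> R by ring.
apply: lerD; first by rewrite normrM ler_pM // norm_character_sum.
apply: le_trans (ler_norm_sum _ _ _) _.
apply: (@le_trans _ _ (\sum_(i < m) q%:R)).
  apply: ler_sum => i _; rewrite normrM -[leRHS]mulr1 ler_pM //; exact: norm_character_sum.
by rewrite sumr_const card_ord mulr_natl.
Qed.
End CharacterSums.

(** * Convergence of the series, with one-sided control by the cutoff *)

Section SeriesLimit.
Variables (R : realType) (c : nat -> R) (s C : R).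
Hypothesis s_ge0 : 0 <= s.
Hypothesis C_ge0 : 0 <= C.
Hypothesis tent_bound : forall K N, (N <= K)%N ->
  `|\sum_(n < K) c n *+ tent N n| <= s * N%:R / 2.
Hypothesis lipschitz_bound : forall (h : nat -> R) m, h 0%N = 0 ->
  (forall n, `|h n.+1 - h n| <= 1) -> `|\sum_(n < m) c n * h n| <= C * m%:R.

Let F N := \sum_(n < N) c n * cutoff R N n.

Lemma cutoff_sum_widen K N : (N <= K)%N -> \sum_(n < K) c n * cutoff R N n = F N.
Proof.
move=> leNK; rewrite /F -!(big_mkord xpredT (fun n => c n * cutoff R N n)).
rewrite (big_cat_nat (leq0n N) leNK) /= -[RHS]addr0; congr (_ + _).
by rewrite big_nat_cond big1 // => n; rewrite andbT => /andP[leNn _]; rewrite cutoff_eq0 ?mulr0.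
Qed.

(** The increment is a single weighted tent, at most 2 s / ((N + 1) (N + 3)). The telescoping
    majorant makes [U] nonincreasing, so its limit lies below each of its terms. *)
Let F_step N : `|F N.+2 - F N.+1| <= 2 * s / N.+1%:R - 2 * s / N.+2%:R.
Proof.
rewrite -(@cutoff_sum_widen N.+2 N.+1) // /F -sumrB.
have -> : \sum_(n < N.+2) (c n * cutoff R N.+2 n - c n * cutoff R N.+1 n)
    = cutoff_weight R N * \sum_(n < N.+2) c n *+ tent N.+2 n.
  rewrite mulr_sumr; apply: eq_bigr => n _; rewrite cutoffS.
  by rewrite -[cutoff_weight R N *+ _]mulr_natr -[c n *+ _]mulr_natr; ring.
rewrite normrM ger0_norm; last exact: ltW (cutoff_weight_gt0 R N).
apply: le_trans (ler_wpM2l (ltW (cutoff_weight_gt0 R N)) (tent_bound (leqnn N.+2))) _.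
have NR : 0 <= (N%:R : R) by [].
rewrite /cutoff_weight -[N.+3%:R]natr1 -[N.+2%:R]natr1 -[N.+1%:R]natr1.
move: (N%:R : R) NR => x x_ge0; rewrite -subr_ge0.
have -> : 2 * s / (x + 1) - 2 * s / (x + 1 + 1) - 4 / ((x + 1) * (x + 1 + 1) * (x + 1 + 1 + 1))
    * (s * (x + 1 + 1) / 2) = 2 * s / ((x + 1) * (x + 1 + 1) * (x + 1 + 1 + 1)).
  by field; rewrite ?lt0r_neq0 //=; lra.
by rewrite divr_ge0 ?mulr_ge0 //; lra.
Qed.

Let U N := F N.+1 + 2 * s / N.+1%:R.

Let U_noninc : nonincreasing_seq U.
Proof.
apply/nonincreasing_seqP => N; have := F_step N; rewrite ler_norml /U => /andP[_ h].
by move: h; move: (F _) (F _) (_ / _) (_ / _) => *; lra.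
Qed.

Let U_cvg : cvgn U.
Proof.
apply: nonincreasing_is_cvgn => //; exists (F 1%N - 2 * s) => _ [N _ <-].
have : F 1%N - 2 * s <= F N.+1 - 2 * s / N.+1%:R.
  elim: N => [|N IHN]; first by rewrite divr1.
  have := F_step N; rewrite ler_norml => /andP[h _]; move: h IHN.
  by move: (F N.+2) (F N.+1) (2 * s / _) (2 * s / _) => *; lra.
have : 0 <= 2 * s / N.+1%:R by rewrite divr_ge0 // mulr_ge0.
by rewrite /U; move: (2 * s / _) => *; lra.
Qed.

Lemma series_limit_le K N : (1 < N <= K)%N ->
  limn U <= \sum_(n < K) c n * cutoff R N n + 2 * s / N%:R.
Proof.
case: N => // N /andP[_ leNK]; rewrite cutoff_sum_widen //.
exact: (nonincreasing_cvgn_ge U_noninc U_cvg N).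
Qed.

(** For n <= K, 1/n is the cutoff at 2 K plus a multiple of n. The difference is thus a combination
    of n and of tents of width up to 2 K, chopped off at K; the bound for full tents does not apply
    to these, but they are 1-Lipschitz. *)
Lemma norm_tail K : (0 < K)%N ->
  `|\sum_(n < K.+1) c n / n%:R - F K| <= 3 * C / K%:R.
Proof.
move=> K_gt0; rewrite -(@cutoff_sum_widen K.+1 K) // -sumrB.
have KR : 0 < (K%:R : R) by rewrite ltr0n.
have le1 : (K.-1 <= (2 * K).-1)%N by lia.
pose w := cutoff_weight R.
have -> : \sum_(n < K.+1) (c n / n%:R - c n * cutoff R K n) =
    \sum_(K.-1 <= k < (2 * K).-1) w k * (\sum_(n < K.+1) c n * (tent k.+2 n)%:R)
    + (K%:R * (2 * K%:R + 1))^-1 * \sum_(n < K.+1) c n * n%:R.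
  under [X in _ = X + _]eq_bigr => k _ do rewrite mulr_sumr.
  rewrite exchange_big /= mulr_sumr -big_split /=; apply: eq_bigr => n _.
  have [->|n_gt0] := posnP n.
    have -> : \sum_(K.-1 <= k < (2 * K).-1) w k * (c 0%N * (tent k.+2 0)%:R) = 0.
      by apply: big1 => k _; rewrite tent0 !mulr0.
    by rewrite cutoff0 invr0 !mulr0 subrr addr0.
  have h := @cutoff_lo R (2 * K) n n_gt0.
  rewrite leq_mul2l -ltnS ltn_ord in h; have {}h := h isT.
  have split : cutoff R (2 * K) n = cutoff R K n
      + \sum_(K.-1 <= k < (2 * K).-1) w k * (tent k.+2 n)%:R.
    rewrite /cutoff -!(big_mkord xpredT (fun k => cutoff_weight R k *+ tent k.+2 n)).
    rewrite (big_cat_nat (leq0n K.-1) le1) /=; congr (_ + _).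
    by apply: eq_bigr => k _; rewrite mulr_natr.
  have nR : 0 < (n%:R : R) by rewrite ltr0n.
  have -> : c n / n%:R - c n * cutoff R K n = c n * (n%:R^-1 - cutoff R (2 * K) n)
      + c n * \sum_(K.-1 <= k < (2 * K).-1) w k * (tent k.+2 n)%:R.
    by rewrite split; ring.
  rewrite h natrM [LHS]addrC; congr (_ + _).
    by rewrite mulr_sumr; apply: eq_bigr => k _; ring.
  by field; rewrite ?lt0r_neq0 //=; lra.
have w_sum : \sum_(K.-1 <= k < (2 * K).-1) w k <= 2 / (K%:R * (K%:R + 1)).
  pose v k : R := - (2 / (k.+1%:R * k.+2%:R)).
  have -> : \sum_(K.-1 <= k < (2 * K).-1) w k = \sum_(K.-1 <= k < (2 * K).-1) (v k.+1 - v k).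
    apply: eq_bigr => k _; rewrite /w /cutoff_weight /v.
    have kR : 0 <= (k%:R : R) by [].
    rewrite -[k.+3%:R]natr1 -[k.+2%:R]natr1 -[k.+1%:R]natr1; move: (k%:R : R) kR => x x_ge0.
    by field; rewrite ?lt0r_neq0 //=; lra.
  rewrite telescope_sumr // /v (prednK K_gt0) -[K.+1%:R]natr1 opprK gerDr oppr_le0.
  by rewrite divr_ge0 // mulr_ge0.
have inner (h : nat -> R) : h 0%N = 0 -> (forall n, `|h n.+1 - h n| <= 1) ->
    `|\sum_(n < K.+1) c n * h n| <= C * (K%:R + 1).
  by move=> h0 hL; rewrite natr1; exact: lipschitz_bound.
apply: le_trans (ler_normD _ _) _.
have t1 : `|\sum_(K.-1 <= k < (2 * K).-1) w k * (\sum_(n < K.+1) c n * (tent k.+2 n)%:R)|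
    <= 2 / (K%:R * (K%:R + 1)) * (C * (K%:R + 1)).
  apply: le_trans (ler_norm_sum _ _ _) _.
  apply: (@le_trans _ _ ((\sum_(K.-1 <= k < (2 * K).-1) w k) * (C * (K%:R + 1)))).
    rewrite mulr_suml; apply: ler_sum => k _.
    rewrite normrM ger0_norm ?ler_wpM2l //; try exact: ltW (cutoff_weight_gt0 R k).
    apply: (inner (fun n => (tent k.+2 n)%:R)) => [|n]; first by rewrite tent0.
    have [le1'|le1'] : (tent k.+2 n.+1 <= tent k.+2 n <= (tent k.+2 n.+1).+1)%N \/
        (tent k.+2 n <= tent k.+2 n.+1 <= (tent k.+2 n).+1)%N by rewrite /tent; lia.
      move: le1'; rewrite -!(ler_nat R) -natr1 => /andP[h1 h2].
      by rewrite ler_norml; apply/andP; split; lra.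
    move: le1'; rewrite -!(ler_nat R) -natr1 => /andP[h1 h2].
    by rewrite ler_norml; apply/andP; split; lra.
  by rewrite ler_wpM2r // mulr_ge0 //; lra.
have t2 : `|(K%:R * (2 * K%:R + 1))^-1 * \sum_(n < K.+1) c n * n%:R|
    <= (K%:R * (K%:R + 1))^-1 * (C * (K%:R + 1)).
  rewrite normrM ger0_norm; last by rewrite invr_ge0 mulr_ge0 //; lra.
  apply: ler_pM; rewrite ?invr_ge0 ?normr_ge0 ?mulr_ge0 //; try lra.
    by rewrite lef_pV2 ?posrE ?mulr_gt0 ?ler_pM2l //; lra.
  by apply: (inner (fun n => n%:R)) => // n; rewrite -natr1 addrAC subrr add0r normr1.
apply: le_trans (lerD t1 t2) _; rewrite le_eqVlt; apply/orP; left; apply/eqP.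
by field; rewrite ?lt0r_neq0 //=; lra.
Qed.

Lemma series_cvg : (fun m => \sum_(n < m.+1) c n / n%:R) @ \oo --> limn U.
Proof.
rewrite -cvg_shiftS /=.
pose E N := \sum_(n < N.+2) c n / n%:R - U N.
have E_le N : `|E N| <= (3 * C + 2 * s) * N.+1%:R^-1.
  have := @norm_tail N.+1 isT; rewrite /E /U.
  have h : 0 <= 2 * s / N.+1%:R by rewrite divr_ge0 // mulr_ge0.
  rewrite [(3 * C + _) * _]mulrDl; move: (\sum_(n < N.+2) _) (F N.+1) => x y hxy.
  have -> : x - (y + 2 * s / N.+1%:R) = (x - y) - 2 * s / N.+1%:R by ring.
  apply: le_trans (ler_normB _ _) (lerD hxy _).
  by rewrite ger0_norm.
have hE : E @ \oo --> (0 : R).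
  have h0 : (fun N => (3 * C + 2 * s) * N.+1%:R^-1) @ \oo --> (0 : R).
    rewrite -[X in _ --> X](mulr0 (3 * C + 2 * s)).
    exact: (cvgM (cvg_cst _) (@cvg_harmonic R)).
  have h0N : (fun N => - ((3 * C + 2 * s) * N.+1%:R^-1)) @ \oo --> (0 : R).
    by rewrite -[X in _ --> X]oppr0; exact: cvgN.
  apply: (squeeze_cvgr _ h0N h0).
  by apply: nearW => N; have := E_le N; rewrite ler_norml.
have -> : (fun m => \sum_(n < m.+2) c n / n%:R) = (fun N => U N + E N).
  by apply/funext => N; rewrite /E subrKC.
rewrite -[limn U]addr0; exact: (cvgD U_cvg hE).
Qed.
End SeriesLimit.

(** * The value at 1 of the Dirichlet series and the conclusion *)

Lemma cpowN1 (R : realType) (n : nat) : cpowN (n.+1%:R : R) 1 = (n.+1%:R^-1)%:C.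
Proof.
rewrite /cpowN /= mul0r cos0 sin0 oppr0 powR_inv1 //.
by rewrite -[X in _ * X]/(1 : R[i]) mulr1.
Qed.

Lemma cvg_real_complex (R : realType) (u : nat -> R) (l : R) :
  u @ \oo --> l -> (fun n => (u n)%:C : R[i]^o) @ \oo --> (l%:C : R[i]^o).
Proof.
move=> ul; apply/cvgrPdist_lt => e e_gt0.
have eE : (complex.Re e)%:C = e by rewrite RRe_real // gtr0_real.
have Re_gt0 : 0 < complex.Re e by rewrite -ltcR eE.
move/cvgrPdist_lt: ul => /(_ _ Re_gt0) [N _ hN]; exists N => // n /hN /= h.
by rewrite -rmorphB /= norm_real_complex -eE ltcR.
Qed.

Lemma dirichletL1 (R : realType) (q : nat) (chi : int -> R[i]) (l : R) :
  quadratic_character q chi ->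
  (fun m => \sum_(n < m.+1) real_character chi n / n%:R) @ \oo --> l ->
  dirichletL chi 1 = l%:C.
Proof.
move=> hquad hl; rewrite /dirichletL.
have -> : (series (fun n : nat => chi n.+1%:Z * cpowN n.+1%:R 1) : R[i]^o ^nat) =
    (fun m => (\sum_(n < m.+1) real_character chi n / n%:R)%:C).
  (* The term n = 0 is a division by zero, hence 0, so the sum over n < m + 1 has exactly the m
     terms of the series. *)
  apply/funext => m; rewrite /series /= big_mkord big_ord_recl invr0 mulr0 add0r rmorph_sum /=.
  by apply: eq_bigr => n _; rewrite cpowN1 (real_characterE hquad) -rmorphM.
have h := cvg_lim (@norm_hausdorff _ (R[i]^o)) (cvg_real_complex hl).
exact: h.
Qed.

(** ln 2 + 49 ln 10 is about 113.5, and half of 113 is what [log_series_bound] asks of ln(sqrt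
    q). *)
Lemma ln_sqrt_ge (R : realType) (q : nat) : 2 * 10 ^+ 49 <= q%:R :> R ->
  ln q%:R = 2 * ln (Num.sqrt q%:R) :> R /\ 113 / 2 <= ln (Num.sqrt (q%:R : R)).
Proof.
move=> q_ge; have p_gt0 : 0 < 10 ^+ 49 :> R by rewrite exprn_gt0.
have q_gt0 : 0 < (q%:R : R) by apply: lt_le_trans q_ge; rewrite mulr_gt0.
have s_gt0 : 0 < Num.sqrt (q%:R : R) by rewrite sqrtr_gt0.
have lnE : ln q%:R = 2 * ln (Num.sqrt q%:R) :> R.
  by rewrite -{1}(sqr_sqrtr (ltW q_gt0)) lnXn // mulr_natl.
split => //.
have := ln_le_mono (mulr_gt0 (ltr0Sn R 1) p_gt0) q_ge.
rewrite lnMpos // lnXn // lnE.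
have -> : ln (10 : R) = ln 2 + ln 5 by exact: (@ln_natM R 2 5).
have [[/andP[l2 _] _ /andP[l5 _] _] _] := ln_small_bounds R.
rewrite -[(ln 2 + ln 5) *+ 49]mulr_natr.
by move: (ln 2) (ln 5) (ln (Num.sqrt _)) l2 l5 => x y z; lra.
Qed.

(* The last inequality is that of R[i]: equal imaginary parts, ordered real parts. *)
Theorem theorem2 (R : realType) (q : nat) (chi : int -> R[i])
  (hchi : dirichlet_character q chi)
  (hprim : primitive_character q chi)
  (hquad : quadratic_character q chi)
  (hq : (even_character chi /\ 2 * 10 ^+ 49 <= q%:R :> R) \/
        (odd_character chi /\ 5 * 10 ^+ 50 <= q%:R :> R)) :
  dirichletL chi 1 <= (9 / 20 * ln (q%:R : R))%:C.
Proof.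
have p_gt0 : 0 < 10 ^+ 49 :> R by rewrite exprn_gt0.
have q_ge : 2 * 10 ^+ 49 <= q%:R :> R.
  case: hq => -[_] //; apply: le_trans; rewrite [10 ^+ 50]exprS.
  by move: (10 ^+ 49 : R) p_gt0 => x; lra.
have q_gt1 : (1 < q)%N.
  rewrite -(ltr_nat R); apply: lt_le_trans q_ge.
  by have := @exprn_ege1 R 49 10 ltac:(lra); move: (10 ^+ 49 : R) => x; lra.
have [lnq ln_ge] := ln_sqrt_ge q_ge.
set s := Num.sqrt q%:R in lnq ln_ge.
have s_gt0 : 0 < s by rewrite sqrtr_gt0 ltr0n ltnW.
have tentB := norm_tent_character_sum hchi hprim hquad q_gt1.
have lipB := norm_lipschitz_character_sum hchi hprim hquad q_gt1.
have C_ge0 : 0 <= 2 * q%:R :> R by rewrite mulr_ge0.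
rewrite (dirichletL1 hquad (series_cvg (ltW s_gt0) C_ge0 tentB lipB)) lecR lnq.
set L := limn _.
have : L <= 9 / 10 * ln s.
  apply: (@log_series_bound R (real_character chi)) => //.
  - exact: real_characterM hchi hquad.
  - exact: real_character_bound hchi hquad q_gt1.
  - by move=> K N leNK; apply: le_trans (tentB K N leNK); exact: ler_norm.
  - exact: (series_limit_le (ltW s_gt0) tentB).
lra.
Qed.
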